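(* Let $\mathcal K$ be one of $\mathcal{LO}_p^H$, $\mathcal{LO}_{sp}^H$, $\mathcal{LO}_r^H$, $\mathcal{LO}_{sr}^H$, where $H$ is any (possibly empty) set of conditions each expressible by a 1-universal sentence. If $\mathcal K$ is nonempty and $\mathcal K^{fg}$ is the class of all finitely generated members of $\mathcal K$, then $\mathcal K^{fg}$ has a Fraïssé limit that belongs to $\mathcal K$.
   Context: $\mathcal{LO}_p$, $\mathcal{LO}_{sp}$, $\mathcal{LO}_r$, $\mathcal{LO}_{sr}$: linearly ordered sets with one unary operation $f$ which is respectively order preserving ($a\le b\Rightarrow f(a)\le f(b)$), strict order preserving ($a<b\Rightarrow f(a)<f(b)$), order reversing ($a\le b\Rightarrow f(a)\ge f(b)$), strict order reversing ($a<b\Rightarrow f(a)>f(b)$). For a set $H$ of conditions, $\mathcal K^H$ is the subclass of structures satisfying all conditions in $H$. A first-order sentence is 1-universal if it is universal and only one variable occurs in it. A Fraïssé limit of a class $\mathcal F$ of finitely generated structures in a countable language is a countable ultrahomogeneous structure whose age (class of finitely generated structures embeddable in it, up to isomorphism) is exactly $\mathcal F$. *)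

(* Defs.v *)
From Stdlib Require Import List Relations FinFun.

Set Implicit Arguments.

(* Structures for the language {<=, f}.  As usual in model theory the domain
   is nonempty: this is what makes "the class is nonempty" a real hypothesis,
   since the empty structure satisfies every universal sentence. *)
Record structure : Type := Structure {
  carrier :> Type;
  le : relation carrier;
  op : carrier -> carrier;
  carrier_inhabited : inhabited carrier
}.

Definition lt (A : structure) (a b : A) : Prop := le A a b /\ a <> b.

Definition linearly_ordered (A : structure) : Prop :=
  order A (le A) /\ forall a b : A, le A a b \/ le A b a.

Definition order_preserving (A : structure) : Prop :=
  forall a b : A, le A a b -> le A (op A a) (op A b).

Definition strict_order_preserving (A : structure) : Prop :=
  forall a b : A, lt A a b -> lt A (op A a) (op A b).

Definition order_reversing (A : structure) : Prop :=
  forall a b : A, le A a b -> le A (op A b) (op A a).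

Definition strict_order_reversing (A : structure) : Prop :=
  forall a b : A, lt A a b -> lt A (op A b) (op A a).

Inductive op_kind : Type := op_p | op_sp | op_r | op_sr.

Definition op_condition (k : op_kind) : structure -> Prop :=
  match k with
  | op_p => order_preserving
  | op_sp => strict_order_preserving
  | op_r => order_reversing
  | op_sr => strict_order_reversing
  end.

Inductive term : Type :=
  | Var (x : nat)
  | Op (t : term).

Inductive formula : Type :=
  | Eq (s t : term)
  | Le (s t : term)
  | Not (phi : formula)
  | And (phi psi : formula)
  | Or (phi psi : formula)
  | Imp (phi psi : formula)
  | Forall (x : nat) (phi : formula)
  | Exists (x : nat) (phi : formula).

Fixpoint eval (A : structure) (v : nat -> A) (t : term) : A :=
  match t with
  | Var x => v x
  | Op t => op A (eval A v t)
  end.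

Definition update (A : structure) (v : nat -> A) (x : nat) (a : A) : nat -> A :=
  fun y => if Nat.eqb y x then a else v y.

Fixpoint sat (A : structure) (v : nat -> A) (phi : formula) : Prop :=
  match phi with
  | Eq s t => eval A v s = eval A v t
  | Le s t => le A (eval A v s) (eval A v t)
  | Not phi => ~ sat A v phi
  | And phi psi => sat A v phi /\ sat A v psi
  | Or phi psi => sat A v phi \/ sat A v psi
  | Imp phi psi => sat A v phi -> sat A v psi
  | Forall x phi => forall a : A, sat A (update A v x a) phi
  | Exists x phi => exists a : A, sat A (update A v x a) phi
  end.

Definition models (A : structure) (phi : formula) : Prop :=
  forall v : nat -> A, sat A v phi.

Fixpoint term_var (t : term) : nat :=
  match t with
  | Var x => x
  | Op t => term_var t
  end.

(* Variables attached to a quantifier count as occurring. *)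
Fixpoint occurs (y : nat) (phi : formula) : Prop :=
  match phi with
  | Eq s t | Le s t => y = term_var s \/ y = term_var t
  | Not phi => occurs y phi
  | And phi psi | Or phi psi | Imp phi psi => occurs y phi \/ occurs y psi
  | Forall x phi | Exists x phi => y = x \/ occurs y phi
  end.

Fixpoint free (y : nat) (phi : formula) : Prop :=
  match phi with
  | Eq s t | Le s t => y = term_var s \/ y = term_var t
  | Not phi => free y phi
  | And phi psi | Or phi psi | Imp phi psi => free y phi \/ free y psi
  | Forall x phi | Exists x phi => y <> x /\ free y phi
  end.

Definition sentence (phi : formula) : Prop := forall y, ~ free y phi.

Fixpoint quantifier_free (phi : formula) : Prop :=
  match phi with
  | Eq _ _ | Le _ _ => True
  | Not phi => quantifier_free phi
  | And phi psi | Or phi psi | Imp phi psi =>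
      quantifier_free phi /\ quantifier_free psi
  | Forall _ _ | Exists _ _ => False
  end.

Inductive universal : formula -> Prop :=
  | universal_qf phi : quantifier_free phi -> universal phi
  | universal_Forall x phi : universal phi -> universal (Forall x phi).

Definition one_universal (phi : formula) : Prop :=
  sentence phi /\ universal phi /\ exists x, forall y, occurs y phi <-> y = x.

(* A condition is any property of structures; it only matters on linearly
   ordered ones, so that is where the sentence has to express it. *)
Definition condition : Type := structure -> Prop.

Definition one_universal_condition (C : condition) : Prop :=
  exists phi, one_universal phi /\
    forall A : structure, linearly_ordered A -> (C A <-> models A phi).

Definition LO (k : op_kind) (H : condition -> Prop) (A : structure) : Prop :=
  linearly_ordered A /\ op_condition k A /\ forall C, H C -> C A.

Definition finitely_generated (A : structure) : Prop :=
  exists l : list A, forall S : A -> Prop,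
    (forall a, In a l -> S a) -> (forall a, S a -> S (op A a)) ->
    forall a, S a.

Definition fg (K : structure -> Prop) (A : structure) : Prop :=
  K A /\ finitely_generated A.

Definition embedding (A B : structure) (h : A -> B) : Prop :=
  Injective h /\
  (forall a b, le A a b <-> le B (h a) (h b)) /\
  (forall a, h (op A a) = op B (h a)).

Definition isomorphism (A B : structure) (h : A -> B) : Prop :=
  embedding A B h /\ Surjective h.

Record substructure (A : structure) : Type := Substructure {
  dom : A -> Prop;
  dom_op : forall a, dom a -> dom (op A a);
  dom_inhabited : exists a, dom a
}.

Definition induced (A : structure) (S : substructure A) : structure :=
  {| carrier := {a : A | dom S a};
     le := fun a b => le A (proj1_sig a) (proj1_sig b);
     op := fun a => exist _ (op A (proj1_sig a)) (dom_op S _ (proj2_sig a));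
     carrier_inhabited :=
       match dom_inhabited S with ex_intro _ a Ha => inhabits (exist _ a Ha) end |}.

Definition ultrahomogeneous (M : structure) : Prop :=
  forall (S T : substructure M) (h : induced S -> induced T),
    finitely_generated (induced S) -> finitely_generated (induced T) ->
    isomorphism (induced S) (induced T) h ->
    exists g : M -> M, isomorphism M M g /\
      forall a : induced S, g (proj1_sig a) = proj1_sig (h a).

Definition age (M : structure) (A : structure) : Prop :=
  finitely_generated A /\ exists h : A -> M, embedding A M h.

(* At most countable; some of the classes only contain finite structures. *)
Definition countable (A : structure) : Prop :=
  exists c : A -> nat, Injective c.

Definition fraisse_limit (F : structure -> Prop) (M : structure) : Prop :=
  countable M /\ ultrahomogeneous M /\ forall A, age M A <-> F A.

(* Main.v *)
(** The proof works with total preorders carrying a monotone operation, whose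
    quotients are the structures of the class.  A 1-universal condition only
    restricts the types of single elements, so it passes to any amalgam in which
    every element comes from one of the two factors.

    Amalgamation of [B] and [C] over [A]: [c < b] is forced when some iterates
    [f^n c] and [f^n b] are separated by an element of [A] (with the order
    reversed for odd [n] if [f] reverses the order).  In the strict case
    [c = b] is forced when some iterates agree in [A].  All other pairs can be
    ordered by a fixed rule, which in the order reversing case depends on the
    side of the centre of the structure, the cut between [x <= f x] and
    [f x <= x].  The centre is adjoined as a fixed point and deleted
    afterwards; this also yields joint embedding.

    Countability: [f^2] preserves the order, so the orbits of two elements under
    [f^2] are monotone.  If they meet, finitely many comparisons determine all
    the others.  If they do not, the comparison of the [i]-th and the [j]-th
    iterate depends monotonically on [i - j] alone.

    The limit is a preorder on [nat * nat], the free algebra on countably many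
    generators, obtained by adding one generator at a time. *)

From Stdlib Require Import Arith Lia List Bool Sumbool FinFun Cantor.
From Stdlib Require Import Classical ClassicalEpsilon.
From Stdlib Require Import FunctionalExtensionality PropExtensionality.
Require Import Defs.
Import ListNotations.

Set Implicit Arguments.
Unset Strict Implicit.

(** * Total preorders with an order preserving or order reversing operation *)

Definition ord (d : bool) (X : Type) (L : X -> X -> Prop) (x y : X) : Prop :=
  if d then L y x else L x y.

(** [mp_strict] expresses strictness as reflection of the order: on linear orders this agrees with
    strict monotonicity, and it passes to pullbacks along maps that need not be injective. *)
Record monotone_preorder (rev strict : bool) (X : Type)
    (L : X -> X -> Prop) (f : X -> X) : Prop := {
  mp_total : forall x y, L x y \/ L y x;
  mp_trans : forall x y z, L x y -> L y z -> L x z;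
  mp_mono : forall x y, L x y -> ord rev L (f x) (f y);
  mp_strict : strict = true -> forall x y, ord rev L (f x) (f y) -> L x y
}.

Section OrdFacts.

Context (rev strict : bool) (X : Type) (L : X -> X -> Prop) (f : X -> X).
Context (HL : monotone_preorder rev strict L f).

Lemma ord_reflexive d x : ord d L x x.
Proof. destruct d; simpl; destruct (mp_total HL x x); auto. Qed.

Lemma ord_transitive d x y z : ord d L x y -> ord d L y z -> ord d L x z.
Proof. destruct d; simpl; intros; eapply (mp_trans HL); eauto. Qed.

(** The operation turns direction [d] into [xorb d rev], so one argument covers an order, its dual
    and both kinds of operation. *)
Lemma ord_mono d x y : ord d L x y -> ord (xorb d rev) L (f x) (f y).
Proof.
  intros h. destruct d; simpl in *; apply (mp_mono HL) in h;
    unfold ord in *; destruct rev; simpl; auto.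
Qed.

Lemma ord_strict d x y :
  strict = true -> ord (xorb d rev) L (f x) (f y) -> ord d L x y.
Proof.
  intros hs h. destruct d; simpl in *; apply (mp_strict HL hs);
    unfold ord in *; destruct rev; simpl in *; auto.
Qed.

End OrdFacts.

Lemma ord_negb d (X : Type) (L : X -> X -> Prop) x y :
  ord (negb d) L x y <-> ord d L y x.
Proof. destruct d; simpl; tauto. Qed.

(** * Amalgamation of two preorders over a common part *)

Section Amalgam.

Context (rev strict : bool) (B C : Type).
Context (LB : B -> B -> Prop) (LC : C -> C -> Prop) (fB : B -> B) (fC : C -> C).
Context (HB : monotone_preorder rev strict LB fB).
Context (HC : monotone_preorder rev strict LC fC).
Context (R : B -> C -> Prop).
Context (R_op : forall b c, R b c -> R (fB b) (fC c)).
Context (R_le : forall b c b' c', R b c -> R b' c' -> (LB b b' <-> LC c c')).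

(** [R] identifies the common part inside both factors, so [a1] and [a2] are one point lying between
    [c] and [b]; [d = false] means that [c] is below [b]. *)
Definition separated (d : bool) (c : C) (b : B) : Prop :=
  exists a1 a2, R a1 a2 /\ ord d LC c a2 /\ ord d LB a1 b.

Inductive forced_lt : bool -> C -> B -> Prop :=
  | forced_lt_base d c b :
      separated d c b -> ~ separated (negb d) c b -> forced_lt d c b
  | forced_lt_op d c b :
      forced_lt (xorb d rev) (fC c) (fB b) -> forced_lt d c b.

Inductive forced_eq : C -> B -> Prop :=
  | forced_eq_base c b :
      separated false c b -> separated true c b -> forced_eq c b
  | forced_eq_op c b :
      strict = true -> forced_eq (fC c) (fB b) -> forced_eq c b.

Lemma R_ord d b c b' c' :
  R b c -> R b' c' -> (ord d LB b b' <-> ord d LC c c').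
Proof. intros h h'. destruct d; simpl; apply R_le; auto. Qed.

Lemma separated_op d c b :
  separated d c b -> separated (xorb d rev) (fC c) (fB b).
Proof.
  intros (a1 & a2 & h & h1 & h2). exists (fB a1), (fC a2).
  split; [auto|]. split; [apply (ord_mono HC)|apply (ord_mono HB)]; auto.
Qed.

(** Two opposite separations squeeze: the separating points bound each other, hence [c] and [b] are
    equivalent to them. *)
Lemma separated_both d c b :
  separated (negb d) c b ->
  forall a1 a2, R a1 a2 -> ord d LC c a2 -> ord d LB a1 b ->
  ord d LC a2 c /\ ord d LB b a1.
Proof.
  intros (a1' & a2' & h' & h1' & h2') a1 a2 h h1 h2.
  rewrite ord_negb in h1', h2'. split.
  - apply (ord_transitive HC) with a2'; auto.
    apply (R_ord d h h'). apply (ord_transitive HB) with b; auto.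
  - apply (ord_transitive HB) with a1'; auto.
    apply (R_ord d h' h). apply (ord_transitive HC) with c; auto.
Qed.

Lemma separated_dec d c b :
  separated d c b -> forced_lt d c b \/ forced_eq c b.
Proof.
  intros h. destruct (classic (separated (negb d) c b)) as [h'|h'].
  - right. apply forced_eq_base; destruct d; auto.
  - left. apply forced_lt_base; auto.
Qed.

(** The opposite forced inequality rests on an iterate separated in one direction only, but the
    given separation persists to every iterate. *)
Lemma separated_not_gt d c b : separated d c b -> ~ forced_lt (negb d) c b.
Proof.
  intros h h'. remember (negb d) as e eqn:He. revert d He h.
  induction h' as [e c b _ h2|e c b _ IH]; intros d -> h.
  - rewrite negb_involutive in h2. auto.
  - apply (IH (xorb d rev)); [symmetry; apply negb_xorb_l|]. apply separated_op; auto.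
Qed.

Lemma forced_lt_asym d c b : forced_lt d c b -> ~ forced_lt (negb d) c b.
Proof.
  induction 1 as [d c b h1 h2|d c b h IH]; intros h'.
  - revert h'. apply separated_not_gt; auto.
  - remember (negb d) as e eqn:He. destruct h' as [e c b h1 h2|e c b h'].
    + subst e. apply separated_op in h1. rewrite <- negb_xorb_l in h1.
      apply separated_not_gt in h1. rewrite negb_involutive in h1. auto.
    + subst e. rewrite <- negb_xorb_l in h'. auto.
Qed.

(** A reverse separation of the images would make them equivalent to the image of the separating
    point, and strictness would pull this back. *)
Lemma forced_lt_strict d c b :
  strict = true -> forced_lt d c b -> forced_lt (xorb d rev) (fC c) (fB b).
Proof.
  intros hs [d' c' b' h1 h2|d' c' b' h]; auto.
  apply forced_lt_base; [apply separated_op; auto|].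
  intros h3. apply h2. destruct (h1) as (a1 & a2 & h & h4 & h5).
  destruct (separated_both h3 (R_op h)) as [h6 h7].
  - apply (ord_mono HC); auto.
  - apply (ord_mono HB); auto.
  - exists a1, a2. rewrite !ord_negb. split; [auto|].
    split; [apply (ord_strict HC)|apply (ord_strict HB)]; auto.
Qed.

Lemma forced_eq_not_lt d c b : forced_eq c b -> ~ forced_lt d c b.
Proof.
  intros h. revert d. induction h as [c b h1 h2|c b hs h IH]; intros d h'.
  - assert (h : separated (negb d) c b) by (destruct d; auto).
    apply separated_not_gt in h. rewrite negb_involutive in h. auto.
  - apply (IH (xorb d rev)). apply forced_lt_strict; auto.
Qed.

Lemma separated_weaken_r d c b b' :
  separated d c b -> ord d LB b b' -> separated d c b'.
Proof.
  intros (a1 & a2 & h & h1 & h2) h3. exists a1, a2. split; [auto|].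
  split; [auto|]. apply (ord_transitive HB) with b; auto.
Qed.

Lemma separated_weaken_l d c c' b :
  separated d c b -> ord d LC c' c -> separated d c' b.
Proof.
  intros (a1 & a2 & h & h1 & h2) h3. exists a1, a2. split; [auto|].
  split; [|auto]. apply (ord_transitive HC) with c; auto.
Qed.

Lemma forced_lt_weaken_r d c b b' :
  forced_lt d c b -> ord d LB b b' -> forced_lt d c b'.
Proof.
  intros h. revert b'. induction h as [d c b h1 h2|d c b h IH]; intros b' hb.
  - apply forced_lt_base; [eapply separated_weaken_r; eauto|].
    intros h3. apply h2. eapply separated_weaken_r; eauto. apply ord_negb; auto.
  - apply forced_lt_op, IH. apply (ord_mono HB); auto.
Qed.

Lemma forced_lt_weaken_l d c c' b :
  forced_lt d c b -> ord d LC c' c -> forced_lt d c' b.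
Proof.
  intros h. revert c'. induction h as [d c b h1 h2|d c b h IH]; intros c' hc.
  - apply forced_lt_base; [eapply separated_weaken_l; eauto|].
    intros h3. apply h2. eapply separated_weaken_l; eauto. apply ord_negb; auto.
  - apply forced_lt_op, IH. apply (ord_mono HC); auto.
Qed.

(** If the separation opposite to [d] survives the move from [b] to [b'], the squeeze puts [b'] back
    in the class of [b]; strictness carries this back along the iterates. *)
Lemma forced_eq_weaken_r d c b b' :
  forced_eq c b -> ord d LB b b' ->
  forced_lt d c b' \/ forced_eq c b' /\ ord d LB b' b.
Proof.
  intros h. revert d b'.
  induction h as [c b h1 h2|c b hs h IH]; intros d b' hb.
  - assert (h : separated d c b) by (destruct d; auto).
    assert (h' : separated (negb d) c b) by (destruct d; auto).
    assert (h3 := separated_weaken_r h hb).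
    destruct (classic (separated (negb d) c b')) as [h4|h4].
    + right. split; [apply forced_eq_base; destruct d; auto|].
      destruct h as (a1 & a2 & h & h5 & h6).
      apply (ord_transitive HB) with a1; auto.
      apply (separated_both h4 h); auto. apply (ord_transitive HB) with b; auto.
    + left. apply forced_lt_base; auto.
  - destruct (IH (xorb d rev) (fB b')) as [h3|[h3 h4]].
    + apply (ord_mono HB); auto.
    + left. apply forced_lt_op; auto.
    + right. split; [apply forced_eq_op; auto|]. apply (ord_strict HB); auto.
Qed.

Lemma forced_eq_weaken_l d c c' b :
  forced_eq c b -> ord d LC c' c ->
  forced_lt d c' b \/ forced_eq c' b /\ ord d LC c c'.
Proof.
  intros h. revert d c'.
  induction h as [c b h1 h2|c b hs h IH]; intros d c' hc.
  - assert (h : separated d c b) by (destruct d; auto).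
    assert (h' : separated (negb d) c b) by (destruct d; auto).
    assert (h3 := separated_weaken_l h hc).
    destruct (classic (separated (negb d) c' b)) as [h4|h4].
    + right. split; [apply forced_eq_base; destruct d; auto|].
      destruct h as (a1 & a2 & h & h5 & h6).
      apply (ord_transitive HC) with a2; auto.
      apply (separated_both h4 h); auto. apply (ord_transitive HC) with c; auto.
    + left. apply forced_lt_base; auto.
  - destruct (IH (xorb d rev) (fC c')) as [h3|[h3 h4]].
    + apply (ord_mono HC); auto.
    + left. apply forced_lt_op; auto.
    + right. split; [apply forced_eq_op; auto|]. apply (ord_strict HC); auto.
Qed.

Lemma forced_lt_fwd d c b :
  forced_lt d c b ->
  forced_lt (xorb d rev) (fC c) (fB b) \/ forced_eq (fC c) (fB b).
Proof.
  intros [d' c' b' h1 h2|d' c' b' h]; auto.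
  apply separated_dec, separated_op; auto.
Qed.

Lemma forced_eq_fwd c b : forced_eq c b -> forced_eq (fC c) (fB b).
Proof.
  intros [c' b' h1 h2|c' b' hs h]; auto.
  apply separated_op in h1, h2.
  apply forced_eq_base; destruct rev; auto.
Qed.

(** The centre as seen in the two factors, fixed up to equivalence. For an order preserving
    operation [q] is on top, so the branch [~ LC c q] below never occurs. *)
Context (p : B) (q : C) (Rpq : R p q).
Context (p_fix : forall d, ord d LB p (fB p)) (q_fix : forall d, ord d LC q (fC q)).
Context (q_top : rev = false -> forall c, LC c q).

Lemma below_above_forced_lt c b : LC c q -> ~ LB b p -> forced_lt false c b.
Proof.
  intros hc hb. destruct (mp_total HB b p) as [?|hb']; [contradiction|].
  apply forced_lt_base; [exists p, q; auto|].
  intros (a1 & a2 & h & h1 & h2). simpl in *. apply hb.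
  apply (mp_trans HB) with a1; auto. apply (R_le h Rpq).
  apply (mp_trans HC) with c; auto.
Qed.

Lemma above_below_forced_lt c b : ~ LC c q -> LB b p -> forced_lt true c b.
Proof.
  intros hc hb. destruct (mp_total HC c q) as [?|hc']; [contradiction|].
  apply forced_lt_base; [exists p, q; auto|].
  intros (a1 & a2 & h & h1 & h2). simpl in *. apply hc.
  apply (mp_trans HC) with a2; auto. apply (R_le h Rpq).
  apply (mp_trans HB) with b; auto.
Qed.

Lemma above_forced c b : LC q c -> LB b p -> forced_lt true c b \/ forced_eq c b.
Proof. intros. apply separated_dec. exists p, q; auto. Qed.

Lemma below_forced c b : LC c q -> LB p b -> forced_lt false c b \/ forced_eq c b.
Proof. intros. apply separated_dec. exists p, q; auto. Qed.

(* Pairs that the common part does not compare, even after iterating the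
   operation, are ordered with the [B]-side outermost, i.e. farther away from
   the centre [q]: this choice is invariant both under order preserving
   operations (where [q] is the top) and order reversing ones. *)
Definition le_CB (c : C) (b : B) : Prop :=
  LC c q /\ (forced_lt false c b \/ forced_eq c b) \/
  ~ LC c q /\ ~ forced_lt true c b.

Definition le_BC (b : B) (c : C) : Prop :=
  LC c q /\ ~ forced_lt false c b \/
  ~ LC c q /\ (forced_lt true c b \/ forced_eq c b).

Definition amalgam_le (x y : B + C) : Prop :=
  match x, y with
  | inl b, inl b' => LB b b'
  | inr c, inr c' => LC c c'
  | inl b, inr c => le_BC b c
  | inr c, inl b => le_CB c b
  end.

Definition amalgam_op (x : B + C) : B + C :=
  match x with inl b => inl (fB b) | inr c => inr (fC c) end.

Lemma le_BC_CB_total b c : le_BC b c \/ le_CB c b.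
Proof. unfold le_BC, le_CB. tauto. Qed.

Lemma le_B_BC b b' c : LB b b' -> le_BC b' c -> le_BC b c.
Proof.
  intros hb [[h1 h2]|[h1 h2]]; [left|right]; (split; [auto|]).
  - intros h. apply h2. apply forced_lt_weaken_r with b; auto.
  - destruct h2 as [h2|h2]; [left; apply forced_lt_weaken_r with b'; auto|].
    destruct (@forced_eq_weaken_r true _ _ _ h2 hb); tauto.
Qed.

(** The tie rule changes at [q]. If [q] lies between [c] and [c'], the side of [p] on which [b] lies
    already forces one of the comparisons. *)
Lemma le_BC_C b c c' : le_BC b c -> LC c c' -> le_BC b c'.
Proof.
  intros h hc. destruct (classic (LC c' q)) as [hq|hq]; [left|right];
    (split; [auto|]); destruct h as [[h1 h2]|[h1 h2]].
  - intros h. apply h2. apply forced_lt_weaken_l with c'; auto.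
  - exfalso. apply h1. apply (mp_trans HC) with c'; auto.
  - destruct (classic (LB b p)) as [hb|hb].
    + left. apply above_below_forced_lt; auto.
    + exfalso. apply h2. apply below_above_forced_lt; auto.
  - destruct h2 as [h2|h2]; [left; apply forced_lt_weaken_l with c; auto|].
    destruct (@forced_eq_weaken_l true _ _ _ h2 hc); tauto.
Qed.

Lemma le_C_CB c c' b : LC c c' -> le_CB c' b -> le_CB c b.
Proof.
  intros hc h. destruct (classic (LC c q)) as [hq|hq]; [left|right];
    (split; [auto|]); destruct h as [[h1 h2]|[h1 h2]].
  - destruct h2 as [h2|h2]; [left; apply forced_lt_weaken_l with c'; auto|].
    destruct (@forced_eq_weaken_l false _ _ _ h2 hc); tauto.
  - left. apply below_above_forced_lt; auto.
    intros hb. apply h2, above_below_forced_lt; auto.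
  - exfalso. apply hq. apply (mp_trans HC) with c'; auto.
  - intros h. apply h2. apply forced_lt_weaken_l with c; auto.
Qed.

Lemma le_CB_B c b b' : le_CB c b -> LB b b' -> le_CB c b'.
Proof.
  intros [[h1 h2]|[h1 h2]] hb; [left|right]; (split; [auto|]).
  - destruct h2 as [h2|h2]; [left; apply forced_lt_weaken_r with b; auto|].
    destruct (@forced_eq_weaken_r false _ _ _ h2 hb); tauto.
  - intros h. apply h2. apply forced_lt_weaken_r with b'; auto.
Qed.

(** Both hypotheses use the branch for the side of [q] on which [c] lies. There only one of them can
    come from the tie rule; the other is forced and can be weakened along [LB b' b]. *)
Lemma le_BC_CB b c b' : le_BC b c -> le_CB c b' -> LB b b'.
Proof.
  intros h h'. apply NNPP. intros hb.
  destruct (mp_total HB b b') as [?|hb']; [contradiction|].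
  destruct h as [[h1 h2]|[h1 h2]], h' as [[h3 h4]|[h3 h4]]; try contradiction.
  - apply h2. destruct h4 as [h4|h4]; [apply forced_lt_weaken_r with b'; auto|].
    destruct (@forced_eq_weaken_r false _ _ _ h4 hb') as [?|[_ ?]]; auto. contradiction.
  - apply h4. destruct h2 as [h2|h2]; [apply forced_lt_weaken_r with b; auto|].
    destruct (@forced_eq_weaken_r true _ _ _ h2 hb') as [?|[_ ?]]; auto. contradiction.
Qed.

Lemma le_CB_BC c b c' : le_CB c b -> le_BC b c' -> LC c c'.
Proof.
  intros h h'. apply NNPP. intros hc.
  destruct (mp_total HC c c') as [?|hc']; [contradiction|].
  destruct h as [[h1 h2]|[h1 h2]], h' as [[h3 h4]|[h3 h4]].
  - apply h4. destruct h2 as [h2|h2]; [apply forced_lt_weaken_l with c; auto|].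
    destruct (@forced_eq_weaken_l false _ _ _ h2 hc') as [?|[_ ?]]; auto. contradiction.
  - apply h3. apply (mp_trans HC) with c; auto.
  - destruct (classic (LB b p)) as [hb|hb].
    + apply h2, above_below_forced_lt; auto.
    + apply h4, below_above_forced_lt; auto.
  - apply h2. destruct h4 as [h4|h4]; [apply forced_lt_weaken_l with c'; auto|].
    destruct (@forced_eq_weaken_l true _ _ _ h4 hc') as [?|[_ ?]]; auto. contradiction.
Qed.

Lemma le_BC_not_gt b c : le_BC b c -> ~ forced_lt false c b.
Proof.
  intros [[h1 h2]|[h1 [h2|h2]]] h; auto.
  - apply (forced_lt_asym h); auto.
  - apply (forced_eq_not_lt h2 h).
Qed.

Lemma le_CB_not_gt c b : le_CB c b -> ~ forced_lt true c b.
Proof.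
  intros [[h1 [h2|h2]]|[h1 h2]] h; auto.
  - apply (forced_lt_asym h); auto.
  - apply (forced_eq_not_lt h2 h).
Qed.

Lemma q_fC d c : rev = true -> ord d LC c q -> ord (negb d) LC (fC c) q.
Proof.
  intros hr h. apply (ord_mono HC) in h. rewrite hr, xorb_true_r in h.
  apply (ord_transitive HC) with (fC q); auto.
  apply ord_negb. apply q_fix.
Qed.

(** An order reversing operation exchanges the sides of [q], and with them the branches of the tie
    rule, so the choice made for [c] and [b] reappears reversed. *)
Lemma le_CB_mono c b :
  le_CB c b -> ord rev amalgam_le (inr (fC c)) (inl (fB b)).
Proof.
  intros h. unfold ord.
  destruct (sumbool_of_bool rev) as [hr|hr]; rewrite hr; simpl.
  - destruct h as [[h1 h2]|[h1 h2]].
    + assert (h3 : forced_lt true (fC c) (fB b) \/ forced_eq (fC c) (fB b)).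
      { destruct h2 as [h2|h2]; [|right; apply forced_eq_fwd; auto].
        apply forced_lt_fwd in h2. rewrite hr in h2. auto. }
      destruct (classic (LC (fC c) q)) as [h4|h4]; [left|right; auto].
      split; [auto|]. intros h5. destruct h3 as [h3|h3].
      * apply (forced_lt_asym h5); auto.
      * apply (forced_eq_not_lt h3 h5).
    + left. split.
      * apply (@q_fC true); auto. destruct (mp_total HC c q); [contradiction|auto].
      * intros h. apply h2, forced_lt_op. rewrite hr. auto.
  - left. split; [auto|]. destruct h as [[h1 h2]|[h1 h2]].
    + destruct h2 as [h2|h2]; [|right; apply forced_eq_fwd; auto].
      apply forced_lt_fwd in h2. rewrite hr in h2. auto.
    + exfalso. auto.
Qed.

Lemma le_BC_mono b c :
  le_BC b c -> ord rev amalgam_le (inl (fB b)) (inr (fC c)).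
Proof.
  intros h. unfold ord.
  destruct (sumbool_of_bool rev) as [hr|hr]; rewrite hr; simpl.
  - destruct h as [[h1 h2]|[h1 h2]].
    + assert (h3 : ~ forced_lt true (fC c) (fB b)).
      { intros h. apply h2, forced_lt_op. rewrite hr. auto. }
      destruct (classic (LC (fC c) q)) as [h4|h4]; [left|right; auto].
      split; [auto|].
      (* Both [c] and [fC c] lie below [q], so [fC c] is equivalent to [q], and the position of [b]
         relative to [p] settles the comparison. *)
      destruct (classic (LB b p)) as [hb|hb].
      * apply below_forced; auto.
        apply (mp_mono HB) in hb. rewrite hr in hb. simpl in hb.
        apply (mp_trans HB) with (fB p); auto. apply (p_fix false).
      * exfalso. apply h2, below_above_forced_lt; auto.
    + left. split.
      * apply (@q_fC true); auto. destruct (mp_total HC c q); [contradiction|auto].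
      * destruct h2 as [h2|h2]; [|right; apply forced_eq_fwd; auto].
        apply forced_lt_fwd in h2. rewrite hr in h2. auto.
  - left. split; [auto|]. intros h1. destruct h as [[h2 h3]|[h2 h3]]; auto.
    apply h3, forced_lt_op. rewrite hr. auto.
Qed.

Lemma le_CB_strict c b : strict = true ->
  ord rev amalgam_le (inr (fC c)) (inl (fB b)) -> le_CB c b.
Proof.
  intros hs h. unfold ord in h.
  destruct (sumbool_of_bool rev) as [hr|hr]; rewrite hr in h; simpl in h.
  - assert (h0 : ~ forced_lt true c b).
    { intros h1. apply (forced_lt_strict hs) in h1. rewrite hr in h1.
      apply (le_BC_not_gt h h1). }
    destruct (classic (LC c q)) as [hc|hc]; [left|right; auto].
    split; [auto|]. destruct h as [[h1 h2]|[h1 h2]].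
    (* Strictness pulls [fC c <= q] back to [q <= c]; as also [c <= q], the centre compares [c] with
       [b]. *)
    + assert (hc' : LC q c).
      { apply (@ord_strict _ _ _ _ _ HC false _ _ hs). rewrite hr. simpl.
        apply (mp_trans HC) with q; auto. apply (q_fix false). }
      destruct (mp_total HB b p) as [hb|hb].
      * destruct (above_forced hc' hb); tauto.
      * apply below_forced; auto.
    + destruct h2 as [h2|h2].
      * left. apply forced_lt_op. rewrite hr. auto.
      * right. apply forced_eq_op; auto.
  - left. split; [auto|]. destruct h as [[h1 [h2|h2]]|[h1 h2]].
    + left. apply forced_lt_op. rewrite hr. auto.
    + right. apply forced_eq_op; auto.
    + exfalso; auto.
Qed.

Lemma le_BC_strict b c : strict = true ->
  ord rev amalgam_le (inl (fB b)) (inr (fC c)) -> le_BC b c.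
Proof.
  intros hs h. unfold ord in h.
  destruct (sumbool_of_bool rev) as [hr|hr]; rewrite hr in h; simpl in h.
  - assert (h0 : ~ forced_lt false c b).
    { intros h1. apply (forced_lt_strict hs) in h1. rewrite hr in h1.
      apply (le_CB_not_gt h h1). }
    destruct (classic (LC c q)) as [hc|hc]; [left; auto|right].
    split; [auto|]. destruct h as [[h1 [h2|h2]]|[h1 h2]].
    + left. apply forced_lt_op. rewrite hr. auto.
    + right. apply forced_eq_op; auto.
    + exfalso. apply h1. apply (@q_fC true); auto.
      destruct (mp_total HC c q); [contradiction|auto].
  - left. split; [auto|]. destruct h as [[h1 h2]|[h1 h2]].
    + intros h. apply (forced_lt_strict hs) in h. rewrite hr in h. auto.
    + exfalso; auto.
Qed.

Lemma amalgam_monotone : monotone_preorder rev strict amalgam_le amalgam_op.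
Proof.
  split.
  - intros [b|c] [b'|c']; simpl; try apply (mp_total HB); try apply (mp_total HC).
    + apply le_BC_CB_total.
    + apply or_comm, le_BC_CB_total.
  - intros [b|c] [b'|c'] [b''|c'']; simpl.
    + apply (mp_trans HB).
    + apply le_B_BC.
    + apply le_BC_CB.
    + apply le_BC_C.
    + apply le_CB_B.
    + apply le_CB_BC.
    + apply le_C_CB.
    + apply (mp_trans HC).
  - intros [b|c] [b'|c'] h; simpl.
    + assert (h' := mp_mono HB h). destruct rev; auto.
    + apply le_BC_mono; auto.
    + apply le_CB_mono; auto.
    + assert (h' := mp_mono HC h). destruct rev; auto.
  - intros hs [b|c] [b'|c'] h; simpl in *.
    + apply (mp_strict HB hs). destruct rev; auto.
    + apply le_BC_strict; auto.
    + apply le_CB_strict; auto.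
    + apply (mp_strict HC hs). destruct rev; auto.
Qed.

Lemma amalgam_glue b c :
  R b c -> amalgam_le (inl b) (inr c) /\ amalgam_le (inr c) (inl b).
Proof.
  intros h.
  assert (hs : forall d, separated d c b).
  { intros d. exists b, c. split; [auto|].
    split; [apply (ord_reflexive HC)|apply (ord_reflexive HB)]. }
  assert (he : forced_eq c b) by (apply forced_eq_base; auto).
  simpl. unfold le_BC, le_CB.
  assert (h1 := @forced_eq_not_lt true _ _ he).
  assert (h2 := @forced_eq_not_lt false _ _ he). tauto.
Qed.

End Amalgam.

(** * Element types, adjoining the centre, and the amalgamation property *)

Section Types.

Context (rev strict : bool) (T : (nat -> nat -> Prop) -> Prop).

(** [T] collects the admissible types of single elements, a type being the order pattern of the
    orbit of [x]. *)
Record good (X : Type) (L : X -> X -> Prop) (f : X -> X) : Prop := {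
  good_mp : monotone_preorder rev strict L f;
  good_type : forall x, T (fun m n => L (Nat.iter m f x) (Nat.iter n f x))
}.

Lemma iter_morphism (X Y : Type) (f : X -> X) (g : Y -> Y) (h : Y -> X) :
  (forall y, h (g y) = f (h y)) ->
  forall n y, h (Nat.iter n g y) = Nat.iter n f (h y).
Proof. intros H n y. induction n; simpl; [auto|]. rewrite H, IHn. auto. Qed.

Lemma good_pullback (X Y : Type) (L : X -> X -> Prop) (f : X -> X)
    (g : Y -> Y) (h : Y -> X) :
  good L f -> (forall y, h (g y) = f (h y)) ->
  good (fun y y' => L (h y) (h y')) g.
Proof.
  intros [HL HT] H. split; [split|].
  - intros x y. apply (mp_total HL).
  - intros x y z. apply (mp_trans HL).
  - intros x y hxy. apply (mp_mono HL) in hxy. rewrite <- !H in hxy.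
    destruct rev; auto.
  - intros hs x y hxy. apply (mp_strict HL hs). rewrite <- !H.
    destruct rev; auto.
  - intros y. specialize (HT (h y)).
    replace (fun m n => L (h (Nat.iter m g y)) (h (Nat.iter n g y)))
      with (fun m n => L (Nat.iter m f (h y)) (Nat.iter n f (h y))); auto.
    extensionality m. extensionality n.
    rewrite !(iter_morphism H). auto.
Qed.

(* The extra point is a common fixed point: it is the top element in the order
   preserving case, and in the order reversing case it fills the cut between
   [x <= f x] and [f x <= x]. *)
Definition centred_le (X : Type) (L : X -> X -> Prop) (f : X -> X)
    (u v : option X) : Prop :=
  match u, v with
  | Some x, Some y => L x y
  | Some x, None => rev = true -> L x (f x)
  | None, Some y => rev = true /\ L (f y) y
  | None, None => True
  end.

(** For a reversing [f], the points with [x <= f x] are closed downwards: [x <= y <= f y] gives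
    [f y <= f x]. They lie below each [z] with [f z <= z], since [z <= x] would give
    [x <= f x <= f z <= z]. *)
Lemma centred_monotone (X : Type) (L : X -> X -> Prop) (f : X -> X) :
  monotone_preorder rev strict L f ->
  monotone_preorder rev strict (centred_le L f) (option_map f).
Proof.
  intros HL. split.
  - intros [x|] [y|]; simpl; auto.
    + apply (mp_total HL).
    + destruct rev; [|left; discriminate].
      destruct (mp_total HL x (f x)); auto.
    + destruct rev; [|right; discriminate].
      destruct (mp_total HL y (f y)); auto.
  - intros [x|] [y|] [z|]; simpl; try tauto.
    + apply (mp_trans HL).
    + intros h h' hr. apply (mp_trans HL) with y; auto.
      apply (mp_trans HL) with (f y); auto.
      apply (mp_mono HL) in h. rewrite hr in h. auto.
    + intros h [hr h']. destruct (mp_total HL x z) as [?|h2]; auto.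
      apply (mp_mono HL) in h2. rewrite hr in h2. simpl in h2.
      apply (mp_trans HL) with (f x); auto.
      apply (mp_trans HL) with (f z); auto.
    + intros [hr h] h'. split; [auto|]. assert (h2 := mp_mono HL h').
      rewrite hr in h2. simpl in h2.
      apply (mp_trans HL) with (f y); auto. apply (mp_trans HL) with y; auto.
  - assert (hf := @mp_mono _ _ _ _ _ HL). unfold ord in *.
    destruct (sumbool_of_bool rev) as [hr|hr]; rewrite hr in hf |- *;
      intros [x|] [y|] h; simpl in *; intuition (solve [auto | congruence]).
  - intros hs. assert (hf := @mp_strict _ _ _ _ _ HL hs). unfold ord in *.
    destruct (sumbool_of_bool rev) as [hr|hr]; rewrite hr in hf |- *;
      intros [x|] [y|] h; simpl in *; intuition (solve [auto | congruence]).
Qed.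

Lemma amalgamation (B C : Type) (LB : B -> B -> Prop) (fB : B -> B)
    (LC : C -> C -> Prop) (fC : C -> C) (R : B -> C -> Prop) :
  good LB fB -> good LC fC ->
  (forall b c, R b c -> R (fB b) (fC c)) ->
  (forall b c b' c', R b c -> R b' c' -> (LB b b' <-> LC c c')) ->
  exists (L : B + C -> B + C -> Prop),
    good L (amalgam_op fB fC) /\
    (forall b b', L (inl b) (inl b') <-> LB b b') /\
    (forall c c', L (inr c) (inr c') <-> LC c c') /\
    (forall b c, R b c -> L (inl b) (inr c) /\ L (inr c) (inl b)).
Proof.
  intros [HB TB] [HC TC] R_op R_le.
  (* [R'] also matches the two centres. It is nonempty even if [R] is empty, so joint embedding is a
     special case. *)
  set (R' := fun b c => match b, c with
    | Some b, Some c => R b c | None, None => True | _, _ => False end).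
  set (L' := amalgam_le rev strict (centred_le LB fB) (centred_le LC fC)
    (option_map fB) (option_map fC) R' None).
  set (h := fun x : B + C => match x with
    | inl b => inl (Some b) | inr c => inr (Some c) end).
  assert (R'_op : forall b c, R' b c -> R' (option_map fB b) (option_map fC c)).
  { intros [b|] [c|]; simpl; auto. }
  assert (R'_le : forall b c b' c', R' b c -> R' b' c' ->
      (centred_le LB fB b b' <-> centred_le LC fC c c')).
  { intros [b|] [c|] [b'|] [c'|]; simpl; try tauto.
    - apply R_le.
    - intros hbc _. rewrite (R_le _ _ _ _ hbc (R_op _ _ hbc)). tauto.
    - intros _ hbc. rewrite (R_le _ _ _ _ (R_op _ _ hbc) hbc). tauto. }
  assert (HL' : monotone_preorder rev strict L'
      (amalgam_op (option_map fB) (option_map fC))).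
  { apply (@amalgam_monotone _ _ _ _ _ _ _ _ (centred_monotone HB)
      (centred_monotone HC) R' R'_op R'_le None None); simpl; auto.
    - intros []; simpl; auto.
    - intros []; simpl; auto.
    - intros hr []; simpl; auto. congruence. }
  exists (fun x y => L' (h x) (h y)).
  split; [|split; [|split]].
  - split.
    + assert (hh : forall x, h (amalgam_op fB fC x) =
        amalgam_op (option_map fB) (option_map fC) (h x)) by (intros []; auto).
      split.
      * intros x y. apply (mp_total HL').
      * intros x y z. apply (mp_trans HL').
      * intros x y hxy. apply (mp_mono HL') in hxy. rewrite <- !hh in hxy.
        destruct rev; auto.
      * intros hs x y hxy. apply (mp_strict HL' hs). rewrite <- !hh.
        destruct rev; auto.
    + intros [b|c].
      * specialize (TB b).
        match goal with |- T ?r => replace r with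
          (fun m n => LB (Nat.iter m fB b) (Nat.iter n fB b)) end; auto.
        extensionality m. extensionality n.
        rewrite <- !(iter_morphism (f := amalgam_op fB fC) (g := fB)
          (h := inl)) by auto. auto.
      * specialize (TC c).
        match goal with |- T ?r => replace r with
          (fun m n => LC (Nat.iter m fC c) (Nat.iter n fC c)) end; auto.
        extensionality m. extensionality n.
        rewrite <- !(iter_morphism (f := amalgam_op fB fC) (g := fC)
          (h := inr)) by auto. auto.
  - intros b b'. simpl. tauto.
  - intros c c'. simpl. tauto.
  - intros b c hbc. apply (@amalgam_glue _ _ _ _ _ _ _ _ (centred_monotone HB)
      (centred_monotone HC) R' R'_op R'_le None (Some b) (Some c)); auto.
Qed.

End Types.

(** * Codes for finite sequences and for the types of tuples *)

Fixpoint component (s i : nat) : nat :=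
  match i with
  | 0 => fst (of_nat s)
  | S i => component (snd (of_nat s)) i
  end.

(** Iterated Cantor unpairing reads every number as an infinite sequence, of which any finite
    initial segment can be prescribed. *)
Lemma component_surj (k : nat) (g : nat -> nat) :
  exists s, forall i, i < k -> component s i = g i.
Proof.
  revert g. induction k as [|k IH]; intros g.
  - exists 0. lia.
  - destruct (IH (fun i => g (S i))) as [s hs].
    exists (to_nat (g 0, s)).
    intros [|i] hi; cbn [component]; rewrite cancel_of_to; cbn [fst snd].
    + auto.
    + apply hs. lia.
Qed.

(** [t] is one more than the least index satisfying [P]; [0] encodes that there is none. *)
Lemma threshold (P : nat -> Prop) :
  (forall n, P n -> P (S n)) ->
  exists t, forall n, P n <-> 0 < t <= S n.
Proof.
  intros mono. destruct (classic (exists n, P n)) as [hex|hex].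
  - destruct (dec_inh_nat_subset_has_unique_least_element P
      (fun n => classic (P n)) hex) as [t [[h1 h2] _]].
    exists (S t). intros n. split.
    + intros h. apply h2 in h. lia.
    + intros h. assert (h3 : t <= n) by lia. clear h. induction h3; auto.
  - exists 0. intros n. split; [|lia]. intros h. exfalso. eauto.
Qed.

Lemma component2_surj (k : nat) (g : nat -> nat -> nat) :
  exists s, forall i j, i < k -> j < k -> component (component s i) j = g i j.
Proof.
  destruct (choice (fun i s => forall j, j < k -> component s j = g i j))
    as [h hh].
  { intros i. apply component_surj. }
  destruct (component_surj k h) as [s hs].
  exists s. intros i j hi hj. rewrite hs; auto.
Qed.

(** [d] is the direction of the orbit, [0] for increasing. The orbit is constant up to equivalence
    from index [t - 1] on; [t = 0] means that it never becomes so. *)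
Definition orbit_type (d t m n : nat) : Prop :=
  match d with
  | 0 => m <= n \/ 0 < t <= S n
  | _ => n <= m \/ 0 < t <= S m
  end.

Section Orbits.

Context (X : Type) (L : X -> X -> Prop) (g : X -> X).
Context (HL : monotone_preorder false false L g).

Lemma increasing_orbit_type x :
  L x (g x) ->
  exists t, forall m n,
    L (Nat.iter m g x) (Nat.iter n g x) <-> m <= n \/ 0 < t <= S n.
Proof.
  intros hx.
  assert (hinc : forall m, L (Nat.iter m g x) (Nat.iter (S m) g x)).
  { intros m. induction m as [|m IH]; [auto|]. apply (mp_mono HL IH). }
  assert (hle : forall m n, m <= n -> L (Nat.iter m g x) (Nat.iter n g x)).
  { intros m n h. induction h as [|n h IH]; [apply (@ord_reflexive _ _ _ _ _ HL false)|].
    apply (mp_trans HL) with (Nat.iter n g x); auto. }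
  destruct (threshold (P := fun n => L (Nat.iter (S n) g x) (Nat.iter n g x)))
    as [t ht].
  { intros n h. apply (mp_mono HL h). }
  exists t. intros m n. rewrite <- ht. split.
  - intros h. destruct (Nat.le_gt_cases m n) as [?|hmn]; [auto|right].
    apply (mp_trans HL) with (Nat.iter m g x); auto.
  - intros [h|h]; [auto|].
    destruct (Nat.le_gt_cases m n) as [?|hmn]; [auto|].
    assert (h2 : forall j, L (Nat.iter (S (j + n)) g x) (Nat.iter (j + n) g x)).
    { intros j. induction j as [|j IH]; [auto|]. apply (mp_mono HL IH). }
    replace m with ((m - n) + n) by lia. generalize (m - n) as j.
    induction j as [|j IH]; [apply (@ord_reflexive _ _ _ _ _ HL false)|].
    apply (mp_trans HL) with (Nat.iter (j + n) g x); auto. apply h2.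
Qed.

End Orbits.

Lemma monotone_preorder_flip (X : Type) (L : X -> X -> Prop) (g : X -> X) :
  monotone_preorder false false L g ->
  monotone_preorder false false (fun x y => L y x) g.
Proof.
  intros HL. split.
  - intros x y. apply (mp_total HL).
  - intros x y z h1 h2. apply (mp_trans HL h2 h1).
  - intros x y h. apply (mp_mono HL h).
  - discriminate.
Qed.

Lemma orbit_type_spec (X : Type) (L : X -> X -> Prop) (g : X -> X) x :
  monotone_preorder false false L g ->
  exists d t, forall m n,
    L (Nat.iter m g x) (Nat.iter n g x) <-> orbit_type d t m n.
Proof.
  intros HL. destruct (mp_total HL x (g x)) as [h|h].
  - exists 0. apply (increasing_orbit_type HL h).
  - destruct (increasing_orbit_type (monotone_preorder_flip HL) h) as [t ht].
    exists 1, t. intros m n. apply ht.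
Qed.

(* In mode 0 the orbits meet in [x_m = y_l]; in the other modes they do not, so
   the comparison of [x_i] with [y_j] depends only on [i - j], monotonically. *)
Definition pair_type (mode d1 t1 d2 t2 m l tab i j : nat) : Prop :=
  match mode with
  | 0 => if l <=? j then orbit_type d1 t1 i (m + (j - l))
         else if m <=? i then orbit_type d2 t2 (l + (i - m)) j
         else component tab (i * l + j) = 1
  | 1 => True
  | 2 => False
  | 3 => i + m < l + j
  | _ => l + j <= i + m
  end.

(** By diagonal invariance [P i j] depends only on [i - j]; being antitone there, it is constant or
    has a single cut, at the integer [l - m]. *)
Lemma diagonal_antitone (P : nat -> nat -> Prop) :
  (forall i j, P i j <-> P (S i) (S j)) ->
  (forall i j, P (S i) j -> P i j) ->
  (forall i j, P i j) \/ (forall i j, ~ P i j) \/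
  exists m l, forall i j, P i j <-> i + m < l + j.
Proof.
  intros hd ha.
  assert (hd' : forall a i j, P i j <-> P (i + a) (j + a)).
  { intros a i j. induction a as [|a IH]; [rewrite !Nat.add_0_r; tauto|].
    rewrite IH, hd, !Nat.add_succ_r. tauto. }
  assert (ha' : forall i i' j, i <= i' -> P i' j -> P i j).
  { intros i i' j h. induction h; auto. }
  destruct (classic (forall i j, P i j)) as [h|h]; [auto|right].
  destruct (classic (forall i j, ~ P i j)) as [h'|h']; [auto|right].
  apply not_all_ex_not in h as [i1 h]. apply not_all_ex_not in h as [j1 h].
  apply not_all_ex_not in h' as [i0 h']. apply not_all_ex_not in h' as [j0 h'].
  (* A true and a false instance are moved along their diagonals to the common second index
     [j0 + j1]. *)
  apply NNPP in h'. apply (hd' j1) in h'. rewrite (hd' j0 i1 j1) in h.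
  rewrite (Nat.add_comm j1 j0) in h. set (m := j0 + j1) in *.
  destruct (threshold (P := fun i => ~ P i m)) as [t ht].
  { intros i hi hi'. apply hi. auto. }
  assert (ht0 : 0 < t) by (apply ht in h; lia).
  assert (h0 : P 0 m) by (apply (ha' _ _ _ (Nat.le_0_l _) h')).
  assert (ht1 : 1 < t).
  { apply Nat.nle_gt. intros ht2. apply (proj2 (ht 0)); [lia|auto]. }
  assert (hm : forall i, P i m <-> S i < t).
  { intros i. split.
    - intros hi. apply Nat.nle_gt. intros hi'. apply (proj2 (ht i)); [lia|auto].
    - intros hi. apply NNPP. intros hi'. apply ht in hi'. lia. }
  (* In row [m] the cut is at [t - 1], hence [S m] in place of [m]. *)
  exists (S m), t. intros i j. rewrite (hd' m).
  destruct (Nat.le_gt_cases j (i + m)) as [hj|hj].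
  - replace (i + m) with ((i + m - j) + j) by lia. rewrite (Nat.add_comm j m).
    rewrite <- (hd' j), hm. lia.
  - split; [lia|]. intros _. apply (ha' _ (0 + j)); [lia|].
    rewrite (Nat.add_comm j m). rewrite <- (hd' j). auto.
Qed.

Definition pair_code (s : nat) : nat -> nat -> Prop :=
  pair_type (component s 0) (component s 1) (component s 2) (component s 3)
    (component s 4) (component s 5) (component s 6) (component s 7).

Lemma pair_code_surj mode d1 t1 d2 t2 m l tab :
  exists s, pair_code s = pair_type mode d1 t1 d2 t2 m l tab.
Proof.
  destruct (component_surj 8 (fun i => nth i [mode; d1; t1; d2; t2; m; l; tab] 0))
    as [s hs].
  exists s. unfold pair_code. rewrite !hs by lia. reflexivity.
Qed.

Section Pairs.

Context (X : Type) (L : X -> X -> Prop) (g : X -> X).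
Context (HL : monotone_preorder false false L g).

(** After the meeting point each orbit can be replaced by the other, which reduces a comparison to a
    single orbit. The remaining [m] by [l] block is stored row by row in [tab]. *)
Lemma meeting_pair_type x y m l :
  L (Nat.iter m g x) (Nat.iter l g y) -> L (Nat.iter l g y) (Nat.iter m g x) ->
  exists s, forall i j, pair_code s i j <-> L (Nat.iter i g x) (Nat.iter j g y).
Proof.
  intros h1 h2.
  assert (h3 : forall a, L (Nat.iter (m + a) g x) (Nat.iter (l + a) g y) /\
                         L (Nat.iter (l + a) g y) (Nat.iter (m + a) g x)).
  { intros a. induction a as [|a [IH1 IH2]]; [rewrite !Nat.add_0_r; auto|].
    rewrite !Nat.add_succ_r. split; [apply (mp_mono HL IH1)|apply (mp_mono HL IH2)]. }
  destruct (orbit_type_spec x HL) as (d1 & t1 & hx).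
  destruct (orbit_type_spec y HL) as (d2 & t2 & hy).
  destruct (component_surj (m * l) (fun k =>
    if excluded_middle_informative
      (L (Nat.iter (k / l) g x) (Nat.iter (k mod l) g y)) then 1 else 0))
    as [tab htab].
  destruct (pair_code_surj 0 d1 t1 d2 t2 m l tab) as [s hs].
  exists s. intros i j. rewrite hs. unfold pair_type.
  destruct (Nat.leb_spec l j) as [hj|hj].
  - rewrite <- hx. destruct (h3 (j - l)) as [h4 h5].
    replace (l + (j - l)) with j in * by lia.
    split; intros h; eapply (mp_trans HL); eauto.
  - destruct (Nat.leb_spec m i) as [hi|hi].
    + rewrite <- hy. destruct (h3 (i - m)) as [h4 h5].
      replace (m + (i - m)) with i in * by lia.
      split; intros h; eapply (mp_trans HL); eauto.
    + rewrite htab by nia.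
      rewrite Nat.div_add_l, Nat.div_small, Nat.add_0_r by lia.
      rewrite (Nat.add_comm (i * l)), Nat.Div0.mod_add, Nat.mod_small by lia.
      destruct (excluded_middle_informative _); intuition discriminate.
Qed.

Lemma pair_type_spec x y :
  exists s, forall i j, pair_code s i j <-> L (Nat.iter i g x) (Nat.iter j g y).
Proof.
  destruct (classic (exists m l, L (Nat.iter m g x) (Nat.iter l g y) /\
    L (Nat.iter l g y) (Nat.iter m g x))) as [(m & l & h1 & h2)|hn].
  { apply (meeting_pair_type h1 h2). }
  set (P := fun i j => L (Nat.iter i g x) (Nat.iter j g y)).
  (* A comparison of images pulls back even if [g] is not strict: otherwise the reverse comparison
     would push forward and the orbits would meet. *)
  assert (hd : forall i j, P i j <-> P (S i) (S j)).
  { intros i j. split; intros h; [apply (mp_mono HL h)|].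
    destruct (mp_total HL (Nat.iter i g x) (Nat.iter j g y)) as [?|h']; [auto|].
    exfalso. apply hn. exists (S i), (S j). split; [auto|]. apply (mp_mono HL h'). }
  assert (hmode : forall mode m l,
    (forall i j, pair_type mode 0 0 0 0 m l 0 i j <-> P i j) ->
    exists s, forall i j, pair_code s i j <-> P i j).
  { intros mode m l h. destruct (pair_code_surj mode 0 0 0 0 m l 0) as [s hs].
    exists s. intros i j. rewrite hs. apply h. }
  destruct (mp_total HL x (g x)) as [hx|hx].
  - assert (hinc : forall i, L (Nat.iter i g x) (Nat.iter (S i) g x)).
    { intros i. induction i as [|i IH]; [auto|]. apply (mp_mono HL IH). }
    destruct (@diagonal_antitone P) as [h|[h|(m & l & h)]]; auto.
    + intros i j h. apply (mp_trans HL) with (Nat.iter (S i) g x); auto.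
    + apply (hmode 1 0 0). intros i j. simpl. intuition.
    + apply (hmode 2 0 0). intros i j. simpl. specialize (h i j). tauto.
    + apply (hmode 3 m l). intros i j. rewrite h. simpl. tauto.
  - assert (hinc : forall i, L (Nat.iter (S i) g x) (Nat.iter i g x)).
    { intros i. induction i as [|i IH]; [auto|]. apply (mp_mono HL IH). }
    (* The orbit of [x] decreases, so the complement of [P] is antitone: modes 1 and 2 are
       exchanged, and mode 4 is the complement of mode 3. *)
    destruct (@diagonal_antitone (fun i j => ~ P i j)) as [h|[h|(m & l & h)]].
    + intros i j. rewrite hd. tauto.
    + intros i j h h'. apply h.
      apply (mp_trans HL) with (Nat.iter i g x); auto.
    + apply (hmode 2 0 0). intros i j. simpl. specialize (h i j). tauto.
    + apply (hmode 1 0 0). intros i j. simpl. specialize (h i j). tauto.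
    + apply (hmode 4 m l). intros i j. specialize (h i j). simpl.
      destruct (classic (P i j)); [|intuition lia].
      split; [auto|]. intros _. apply Nat.nlt_ge. tauto.
Qed.

End Pairs.

(* The square of the operation preserves the order for all kinds of operation,
   so each orbit is split into its even and its odd part. *)
Definition tuple_type (s i m j n : nat) : Prop :=
  pair_code (component (component (component s i) j) (2 * (m mod 2) + n mod 2))
    (m / 2) (n / 2).

Lemma iter_half (X : Type) (f : X -> X) n x :
  Nat.iter n f x = Nat.iter (n / 2) (fun y => f (f y)) (Nat.iter (n mod 2) f x).
Proof.
  replace (Nat.iter n f x) with (Nat.iter (2 * (n / 2) + n mod 2) f x)
    by (rewrite <- Nat.div_mod_eq; reflexivity).
  generalize (n / 2) as k, (n mod 2) as r.
  intros k r. induction k as [|k IH]; [reflexivity|].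
  replace (2 * S k + r) with (S (S (2 * k + r))) by lia. simpl in *.
  rewrite IH. reflexivity.
Qed.

Lemma tuple_type_spec (rev strict : bool) (X : Type) (L : X -> X -> Prop)
    (f : X -> X) (k : nat) (e : nat -> X) :
  monotone_preorder rev strict L f ->
  exists s, forall i j, i < k -> j < k -> forall m n,
    tuple_type s i m j n <-> L (Nat.iter m f (e i)) (Nat.iter n f (e j)).
Proof.
  intros HL. set (g := fun y => f (f y)).
  assert (Hg : monotone_preorder false false L g).
  { split.
    - apply (mp_total HL).
    - apply (mp_trans HL).
    - intros x y h. apply (@ord_mono _ _ _ _ _ HL false) in h.
      apply (ord_mono HL) in h. destruct rev; auto.
    - discriminate. }
  assert (hpair : forall i j, exists s, forall m n,
    pair_code (component s (2 * (m mod 2) + n mod 2)) (m / 2) (n / 2) <->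
    L (Nat.iter m f (e i)) (Nat.iter n f (e j))).
  { intros i j.
    (* [r < 4] encodes the two parities, [r / 2] for [m] and [r mod 2] for [n]. *)
    destruct (choice (fun r s => forall a b, pair_code s a b <->
      L (Nat.iter a g (Nat.iter (r / 2) f (e i)))
        (Nat.iter b g (Nat.iter (r mod 2) f (e j))))) as [h hh].
    { intros r. apply (pair_type_spec Hg). }
    destruct (component_surj 4 h) as [s hs].
    exists s. intros m n.
    assert (hm := Nat.mod_upper_bound m 2). assert (hn := Nat.mod_upper_bound n 2).
    rewrite hs, hh by lia.
    rewrite (iter_half f m), (iter_half f n). fold g.
    replace ((2 * (m mod 2) + n mod 2) / 2) with (m mod 2).
    replace ((2 * (m mod 2) + n mod 2) mod 2) with (n mod 2).
    - tauto.
    - rewrite Nat.add_comm, Nat.mul_comm, Nat.Div0.mod_add, Nat.Div0.mod_mod. auto.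
    - rewrite Nat.mul_comm, Nat.div_add_l, (Nat.div_small (n mod 2)); lia. }
  destruct (choice (fun ij s => forall m n,
    pair_code (component s (2 * (m mod 2) + n mod 2)) (m / 2) (n / 2) <->
    L (Nat.iter m f (e (fst ij))) (Nat.iter n f (e (snd ij))))) as [h hh].
  { intros [i j]. apply hpair. }
  destruct (component2_surj k (fun i j => h (i, j))) as [s hs].
  exists s. intros i j hi hj m n. unfold tuple_type. rewrite hs by auto.
  apply hh.
Qed.

(** * Construction of the limit preorder *)

Definition matched (X Y : Type) (LX : X -> X -> Prop) (fX : X -> X)
    (LY : Y -> Y -> Prop) (fY : Y -> Y) (l : list (X * Y)) : Prop :=
  forall u v, In u l -> In v l -> forall m n,
    LX (Nat.iter m fX (fst u)) (Nat.iter n fX (fst v)) <->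
    LY (Nat.iter m fY (snd u)) (Nat.iter n fY (snd v)).

(* [(i, n)] stands for the [n]-th iterate of the [i]-th generator. *)
Definition shift (u : nat * nat) : nat * nat := (fst u, S (snd u)).

Lemma iter_shift n u : Nat.iter n shift u = (fst u, n + snd u).
Proof.
  induction n as [|n IH]; simpl; [destruct u; auto|]. rewrite IH. auto.
Qed.

Lemma iter_shift0 n i : Nat.iter n shift (i, 0) = (i, n).
Proof. rewrite iter_shift. simpl. rewrite Nat.add_0_r. auto. Qed.

Section Limit.

Context (rev strict : bool) (T : (nat -> nat -> Prop) -> Prop).

Definition sequence_le (X : Type) (L : X -> X -> Prop) (f : X -> X)
    (e : nat -> X) (u v : nat * nat) : Prop :=
  L (Nat.iter (snd u) f (e (fst u))) (Nat.iter (snd v) f (e (fst v))).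

Lemma sequence_good (X : Type) (L : X -> X -> Prop) (f : X -> X) (e : nat -> X) :
  good rev strict T L f -> good rev strict T (sequence_le L f e) shift.
Proof.
  intros HL. unfold sequence_le.
  apply (good_pullback (h := fun u => Nat.iter (snd u) f (e (fst u))) HL).
  intros u. reflexivity.
Qed.

Definition agree (N : nat) (p p' : nat * nat -> nat * nat -> Prop) : Prop :=
  forall u v, fst u <= N -> fst v <= N -> (p u v <-> p' u v).

(** A matched list generates a partial isomorphism up to equivalence. [p] and [L] are amalgamated
    over it, and the result is pulled back along a map that keeps the generators up to [N] and sends
    generator [S N] to [x]. *)
Lemma one_point_extension p N (X : Type) (L : X -> X -> Prop) (f : X -> X) l x :
  good rev strict T p shift -> good rev strict T L f ->
  matched L f p shift l -> (forall u, In u l -> fst (snd u) <= N) ->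
  exists p', good rev strict T p' shift /\ agree N p p' /\
    matched L f p' shift ((x, (S N, 0)) :: l).
Proof.
  intros Hp HX Hl HN.
  destruct (@amalgamation rev strict T _ _ p shift L f
    (fun b c => exists u m, In u l /\
       b = Nat.iter m shift (snd u) /\ c = Nat.iter m f (fst u)))
    as (La & Ha & HaB & HaC & HaR); auto.
  { intros b c (u & m & hu & -> & ->). exists u, (S m). auto. }
  { intros b c b' c' (u & m & hu & -> & ->) (u' & m' & hu' & -> & ->).
    symmetry. apply Hl; auto. }
  (* Generators beyond [S N] also go to [x], a default that later stages may override. *)
  set (e := fun i => if i <=? N then inl (i, 0) else inr x).
  assert (heB : forall u, fst u <= N ->
    Nat.iter (snd u) (amalgam_op shift f) (e (fst u)) = inl u).
  { intros [i m] hi. simpl in *. unfold e. apply Nat.leb_le in hi. rewrite hi.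
    rewrite <- (iter_morphism (g := shift) (h := inl)) by reflexivity.
    rewrite iter_shift0. reflexivity. }
  assert (heC : forall m,
    Nat.iter m (amalgam_op shift f) (e (S N)) = inr (Nat.iter m f x)).
  { intros m. unfold e. rewrite (proj2 (Nat.leb_nle (S N) N)) by lia.
    rewrite <- (iter_morphism (g := f) (h := inr)) by reflexivity. reflexivity. }
  exists (sequence_le La (amalgam_op shift f) e).
  split; [apply sequence_good; auto|]. split.
  - intros u v hu hv. unfold sequence_le. rewrite !heB, HaB by auto. tauto.
  - assert (HLa := good_mp Ha).
    assert (hglue : forall u m, In u l ->
      La (inl (Nat.iter m shift (snd u))) (inr (Nat.iter m f (fst u))) /\
      La (inr (Nat.iter m f (fst u))) (inl (Nat.iter m shift (snd u)))).
    { intros u m hu. apply HaR. exists u, m. auto. }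
    assert (hN : forall u m, In u l -> fst (Nat.iter m shift (snd u)) <= N).
    { intros u m hu. rewrite iter_shift. simpl. auto. }
    intros u v [<-|hu] [<-|hv] m n; unfold sequence_le; cbn [fst snd].
    + rewrite !iter_shift0. cbn [fst snd]. rewrite !heC, HaC. tauto.
    + rewrite iter_shift0. cbn [fst snd]. rewrite heC, heB by auto.
      rewrite <- HaC. destruct (hglue v n hv).
      split; intros h; eapply (mp_trans HLa); eauto.
    + rewrite iter_shift0. cbn [fst snd]. rewrite heC, heB by auto.
      rewrite <- HaC. destruct (hglue u m hu).
      split; intros h; eapply (mp_trans HLa); eauto.
    + rewrite !heB, HaB by auto. apply Hl; auto.
Qed.

(* A task [t] codes a finite list of elements of [nat * nat] together with the
   type of a tuple with one more entry. *)
Definition task_length (t : nat) : nat := component t 0.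

Definition task_list (t : nat) : list ((nat * nat) * (nat * nat)) :=
  map (fun i => ((i, 0), of_nat (component (component t 1) i)))
    (seq 0 (task_length t)).

Definition task_type (t : nat) (q : nat * nat -> nat * nat -> Prop) : Prop :=
  forall i j, i <= task_length t -> j <= task_length t -> forall m n,
    tuple_type (component t 2) i m j n <-> q (i, m) (j, n).

Definition solves (N t : nat) (p p' : nat * nat -> nat * nat -> Prop) : Prop :=
  forall q, good rev strict T q shift -> task_type t q ->
    matched q shift p shift (task_list t) ->
    (forall u, In u (task_list t) -> fst (snd u) <= N) ->
    matched q shift p' shift (((task_length t, 0), (S N, 0)) :: task_list t).

Lemma task_list_fst t u :
  In u (task_list t) -> exists i, i < task_length t /\ fst u = (i, 0).
Proof.
  unfold task_list. rewrite in_map_iff. intros (i & <- & hi).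
  apply in_seq in hi. exists i. split; [lia|auto].
Qed.

(** An extension made for one [q] that fits the task serves every other: matching sees only
    generators up to [task_length t], and there [task_type] determines [q]. *)
Lemma extension_step N t p :
  good rev strict T p shift ->
  exists p', good rev strict T p' shift /\ agree N p p' /\ solves N t p p'.
Proof.
  intros Hp.
  destruct (classic (exists q, good rev strict T q shift /\ task_type t q /\
    matched q shift p shift (task_list t) /\
    (forall u, In u (task_list t) -> fst (snd u) <= N)))
    as [(q & Hq & ht & hm & hN)|hn].
  - destruct (one_point_extension (task_length t, 0) Hp Hq hm hN)
      as (p' & Hp' & ha & hm').
    exists p'. split; [auto|]. split; [auto|].
    intros q' Hq' ht' _ _ u v hu hv m n. rewrite <- (hm' u v hu hv m n).
    assert (hfst : forall w, In w (((task_length t, 0), (S N, 0)) :: task_list t) ->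
      exists i, i <= task_length t /\ fst w = (i, 0)).
    { intros w [<-|hw]; [exists (task_length t); auto|].
      apply task_list_fst in hw as (i & hi & ->). exists i. split; [lia|auto]. }
    destruct (hfst u hu) as (i & hi & ->), (hfst v hv) as (j & hj & ->).
    rewrite !iter_shift0, <- (ht i j), <- (ht' i j) by auto. tauto.
  - exists p. split; [auto|]. split; [intros u v; tauto|].
    intros q Hq ht hm hN. exfalso. apply hn. exists q. auto.
Qed.

(** The extension property of a Fraïssé limit, asked for one additional generator at a time. *)
Definition has_extensions (Y : Type) (LY : Y -> Y -> Prop) (fY : Y -> Y) : Prop :=
  forall (X : Type) (L : X -> X -> Prop) (f : X -> X) (l : list (X * Y)) (x : X),
    good rev strict T L f -> matched L f LY fY l ->
    exists y, matched L f LY fY ((x, y) :: l).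

Lemma matched_tuple (X Y : Type) (LX : X -> X -> Prop) (fX : X -> X)
    (LY : Y -> Y -> Prop) (fY : Y -> Y) (l : list (X * Y)) x y :
  (forall i j m n, i < length l -> j < length l ->
    LX (Nat.iter m fX (nth i (map fst l) x)) (Nat.iter n fX (nth j (map fst l) x)) <->
    LY (Nat.iter m fY (nth i (map snd l) y)) (Nat.iter n fY (nth j (map snd l) y)))
  <-> matched LX fX LY fY l.
Proof.
  assert (hfst : forall i, nth i (map fst l) x = fst (nth i l (x, y))).
  { intros i. apply (map_nth fst l (x, y)). }
  assert (hsnd : forall i, nth i (map snd l) y = snd (nth i l (x, y))).
  { intros i. apply (map_nth snd l (x, y)). }
  split.
  - intros h u v hu hv m n.
    apply In_nth with (d := (x, y)) in hu as (i & hi & <-), hv as (j & hj & <-).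
    rewrite <- !hfst, <- !hsnd. auto.
  - intros h i j m n hi hj. rewrite !hfst, !hsnd.
    apply h; apply nth_In; auto.
Qed.

(** The step from stage [N] treats the task in the first component of [of_nat N]; so every task
    recurs after all the generators it mentions have been settled. *)
Lemma limit_exists (X : Type) (L : X -> X -> Prop) (f : X -> X) (x0 : X) :
  good rev strict T L f ->
  exists P, good rev strict T P shift /\ has_extensions P shift.
Proof.
  intros HX.
  set (G := {p | good rev strict T p shift}).
  set (p0 := exist _ _ (sequence_good (fun _ => x0) HX) : G).
  destruct (choice (fun (a : nat * G) (p' : G) =>
    agree (fst a) (proj1_sig (snd a)) (proj1_sig p') /\
    solves (fst a) (fst (of_nat (fst a))) (proj1_sig (snd a)) (proj1_sig p')))
    as [next hnext].
  { intros [N [p Hp]].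
    destruct (extension_step N (fst (of_nat N)) Hp) as (p' & Hp' & h).
    exists (exist _ p' Hp'). exact h. }
  set (stage := fix stage N : G :=
    match N with 0 => p0 | S N => next (N, stage N) end).
  set (p := fun N => proj1_sig (stage N)).
  assert (Hp : forall N, good rev strict T (p N) shift)
    by (intros N; apply (proj2_sig (stage N))).
  assert (hsolves : forall N, solves N (fst (of_nat N)) (p N) (p (S N)))
    by (intros N; apply (hnext (N, stage N))).
  assert (hagree : forall N N' u v, fst u <= N -> fst v <= N -> N <= N' ->
    (p N u v <-> p N' u v)).
  { intros N N' u v hu hv h. induction h as [|N' h IH]; [tauto|].
    rewrite IH. apply (hnext (N', stage N')); simpl; lia. }
  (* Stage [N] is final on generators up to [N], so two elements may be compared at the larger of
     their generators. *)
  set (P := fun u v => p (max (fst u) (fst v)) u v).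
  assert (hP : forall N u v, fst u <= N -> fst v <= N -> (P u v <-> p N u v)).
  { intros N u v hu hv. apply hagree; lia. }
  assert (hPord : forall d N u v, fst u <= N -> fst v <= N ->
    (ord d P u v <-> ord d (p N) u v)).
  { intros d N u v hu hv. destruct d; apply hP; auto. }
  exists P. split; [split; [split|]|].
  - intros u v. set (N := max (fst u) (fst v)).
    rewrite (hP N u v), (hP N v u) by lia. apply (mp_total (good_mp (Hp N))).
  - intros u v w. set (N := max (fst u) (max (fst v) (fst w))).
    rewrite (hP N u v), (hP N v w), (hP N u w) by lia.
    apply (mp_trans (good_mp (Hp N))).
  - intros u v. set (N := max (fst u) (fst v)).
    rewrite (hP N u v) by lia. intros h. apply (mp_mono (good_mp (Hp N))) in h.
    apply (hPord _ N); simpl; auto; lia.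
  - intros hs u v h. set (N := max (fst u) (fst v)).
    apply (hP N); [lia|lia|]. apply (mp_strict (good_mp (Hp N)) hs).
    apply (hPord _ N) in h; simpl; auto; lia.
  - intros u. assert (h := good_type (Hp (fst u)) u).
    match goal with |- T ?r => replace r with (fun m n =>
      p (fst u) (Nat.iter m shift u) (Nat.iter n shift u)) end; auto.
    extensionality m. extensionality n. apply propositional_extensionality.
    rewrite !iter_shift. symmetry. apply hP; simpl; lia.
  - intros Y LY fY l y HY hl.
    set (k := length l).
    (* The default value makes [e k] the new element [y]. *)
    set (e := fun i => nth i (map fst l) y).
    set (a := fun i => nth i (map snd l) (0, 0)).
    destruct (tuple_type_spec (S k) e (good_mp HY)) as [s hs].
    destruct (component_surj k (fun i => to_nat (a i))) as [ca hca].
    destruct (component_surj 3 (fun i => nth i [k; ca; s] 0)) as [t ht].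
    (* Pairing [t] with the largest generator in [l] gives a stage that treats [t] and is not below
       that generator. *)
    set (N := to_nat (t, list_max (map fst (map snd l)))).
    assert (hN : forall i, i < k -> fst (a i) <= N).
    { intros i hi. assert (h1 := to_nat_non_decreasing t
        (list_max (map fst (map snd l)))). fold N in h1.
      assert (h2 := proj1 (list_max_le (map fst (map snd l)) _) (Nat.le_refl _)).
      rewrite Forall_forall in h2.
      apply Nat.le_trans with (list_max (map fst (map snd l))).
      - apply h2, in_map, nth_In. rewrite length_map. auto.
      - lia. }
    assert (htl : task_length t = k) by apply (ht 0 ltac:(lia)).
    assert (hta : forall i, i < k -> of_nat (component (component t 1) i) = a i).
    { intros i hi. rewrite (ht 1) by lia. cbn [nth]. rewrite hca by auto.
      apply cancel_of_to. }
    assert (hlist : forall u, In u (task_list t) ->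
      exists i, i < k /\ u = ((i, 0), a i)).
    { intros u. unfold task_list. rewrite in_map_iff, htl.
      intros (i & <- & hi). apply in_seq in hi. exists i.
      split; [lia|]. rewrite hta by lia. auto. }
    assert (hlist' : forall i, i < k -> In ((i, 0), a i) (task_list t)).
    { intros i hi. unfold task_list. rewrite htl, <- hta by auto.
      apply in_map_iff. exists i. split; [auto|]. apply in_seq. lia. }
    pose proof (hl' := proj2 (matched_tuple LY fY P shift l y (0, 0)) hl).
    assert (hPa : forall i j m n, i < k -> j < k ->
      (P (Nat.iter m shift (a i)) (Nat.iter n shift (a j)) <->
       p N (Nat.iter m shift (a i)) (Nat.iter n shift (a j)))).
    { intros i j m n hi hj. apply hP; rewrite iter_shift; simpl; auto. }
    assert (hsol := hsolves N). unfold N in hsol at 2.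
    rewrite cancel_of_to in hsol. simpl in hsol.
    specialize (hsol (sequence_le LY fY e) (sequence_good e HY)).
    assert (hsol' : matched (sequence_le LY fY e) shift (p (S N)) shift
        (((task_length t, 0), (S N, 0)) :: task_list t)).
    { apply hsol.
      - intros i j hi hj m n. rewrite (ht 2) by lia. apply hs; lia.
      - intros u v hu hv m n.
        apply hlist in hu as (i & hi & ->), hv as (j & hj & ->). simpl.
        rewrite <- hPa by auto. rewrite !iter_shift0. apply hl'; auto.
      - intros u hu. apply hlist in hu as (i & hi & ->). simpl. auto. }
    rewrite htl in hsol'.
    assert (hPp : forall u v, fst u <= S N -> fst v <= S N -> forall m n,
      P (Nat.iter m shift u) (Nat.iter n shift v) <->
      p (S N) (Nat.iter m shift u) (Nat.iter n shift v)).
    { intros u v hu hv m n. apply hP; rewrite iter_shift; simpl; auto. }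
    exists (S N, 0).
    assert (hrel : forall u, In u ((y, (S N, 0)) :: l) -> exists i,
      fst u = e i /\ fst (snd u) <= S N /\
      In ((i, 0), snd u) (((k, 0), (S N, 0)) :: task_list t)).
    { intros u [<-|hu].
      - exists k. simpl. split; [|auto].
        unfold e. rewrite nth_overflow; auto. rewrite length_map. auto.
      - apply In_nth with (d := (y, (0, 0))) in hu as (i & hi & <-).
        exists i. rewrite <- (map_nth fst), <- (map_nth snd). cbn [fst snd].
        split; [auto|]. split; [apply Nat.le_trans with N; [apply hN|]; auto|].
        right. apply hlist'. auto. }
    intros u v hu hv m n.
    destruct (hrel u hu) as (i & -> & hu1 & hu2).
    destruct (hrel v hv) as (j & -> & hv1 & hv2).
    rewrite hPp by auto. specialize (hsol' _ _ hu2 hv2 m n).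
    cbn [fst snd] in hsol'. rewrite <- hsol', !iter_shift0. reflexivity.
Qed.

End Limit.

Lemma matched_swap (X Y : Type) (LX : X -> X -> Prop) (fX : X -> X)
    (LY : Y -> Y -> Prop) (fY : Y -> Y) (l : list (X * Y)) :
  matched LX fX LY fY l ->
  matched LY fY LX fX (map (fun u => (snd u, fst u)) l).
Proof.
  intros h u v hu hv m n.
  apply in_map_iff in hu as (u' & <- & hu), hv as (v' & <- & hv). simpl.
  symmetry. apply h; auto.
Qed.

(** * Quotients of preorders as structures *)

Lemma quotient_structure (rev strict : bool) (X : Type) (L : X -> X -> Prop)
    (f : X -> X) (x0 : X) :
  monotone_preorder rev strict L f ->
  exists (M : structure) (proj : X -> M),
    linearly_ordered M /\ (forall y, exists x, proj x = y) /\
    (forall x x', le M (proj x) (proj x') <-> L x x') /\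
    (forall x, proj (f x) = op M (proj x)).
Proof.
  intros HL.
  set (cls := fun x y => L x y /\ L y x).
  set (Q := {c | exists x, c = cls x}).
  set (proj := fun x => exist _ (cls x) (ex_intro _ x eq_refl) : Q).
  assert (hrefl : forall x, L x x) by (intros x; destruct (mp_total HL x x); auto).
  assert (hproj : forall x y, L x y -> L y x -> proj x = proj y).
  { intros x y h h'. unfold proj.
    assert (e : cls x = cls y).
    { extensionality z. apply propositional_extensionality. unfold cls.
      split; intros [h1 h2]; split; eapply (mp_trans HL); eauto. }
    apply eq_sig_hprop; [intros; apply proof_irrelevance|exact e]. }
  destruct (choice (fun (c : Q) x => proj x = c)) as [rep hrep].
  { intros [c [x hx]]. exists x. apply eq_sig_hprop; [|auto].
    intros; apply proof_irrelevance. }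
  assert (heq : forall x, L (rep (proj x)) x /\ L x (rep (proj x))).
  { intros x. assert (e := f_equal (@proj1_sig _ _) (hrep (proj x))). simpl in e.
    apply (f_equal (fun c => c x)) in e. unfold cls in e.
    change (cls (rep (proj x)) x). unfold cls. rewrite e. auto. }
  set (M := Structure (fun c d : Q => L (rep c) (rep d))
    (fun c => proj (f (rep c))) (inhabits (proj x0))).
  assert (hle : forall x x', le M (proj x) (proj x') <-> L x x').
  { intros x x'. simpl. destruct (heq x), (heq x').
    split; intros h.
    - apply (mp_trans HL) with (rep (proj x)); auto.
      apply (mp_trans HL) with (rep (proj x')); auto.
    - apply (mp_trans HL) with x; auto. apply (mp_trans HL) with x'; auto. }
  exists M, proj. split; [|split; [|split]]; auto.
  - split; [split|].
    + intros c. simpl. auto.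
    + intros a b c. apply (mp_trans HL).
    + intros a b h1 h2. rewrite <- (hrep a), <- (hrep b). auto.
    + intros a b. apply (mp_total HL).
  - intros y. exists (rep y). apply hrep.
  - intros x. simpl. destruct (heq x) as [h1 h2].
    apply (mp_mono HL) in h1, h2. destruct rev; auto.
Qed.

(** * Element types decide 1-universal sentences *)

Definition element_type (A : structure) (a : A) (m n : nat) : Prop :=
  le A (Nat.iter m (op A) a) (Nat.iter n (op A) a).

Fixpoint term_depth (t : term) : nat :=
  match t with Var _ => 0 | Op t => S (term_depth t) end.

Lemma eval_iter (A : structure) v t :
  eval A v t = Nat.iter (term_depth t) (op A) (v (term_var t)).
Proof. induction t as [|t IH]; simpl; [auto|]. rewrite IH. auto. Qed.

Lemma universal_matrix phi :
  universal phi ->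
  exists psi, quantifier_free psi /\ (forall y, occurs y psi -> occurs y phi) /\
    forall A, models A phi <-> models A psi.
Proof.
  induction 1 as [phi h|x phi h (psi & h1 & h2 & h3)].
  - exists phi. split; [auto|]. split; [auto|tauto].
  - exists psi. split; [auto|]. split; [simpl; auto|]. intros A.
    rewrite <- h3. split; intros hm v.
    + assert (hv := hm v (v x)).
      replace (update A v x (v x)) with v in hv; auto.
      extensionality y. unfold update. destruct (Nat.eqb_spec y x); subst; auto.
    + intros a. apply hm.
Qed.

(** Terms are iterates of [op] at a variable, and by antisymmetry an equation is a pair of
    inequalities, so the element type decides every atom. *)
Lemma sat_element_type (A B : structure) x v w psi :
  linearly_ordered A -> linearly_ordered B ->
  element_type (v x) = element_type (w x) ->
  quantifier_free psi -> (forall y, occurs y psi -> y = x) ->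
  (sat A v psi <-> sat B w psi).
Proof.
  intros [[rA _ aA] _] [[rB _ aB] _] ht.
  assert (hle : forall m n,
    le A (Nat.iter m (op A) (v x)) (Nat.iter n (op A) (v x)) <->
    le B (Nat.iter m (op B) (w x)) (Nat.iter n (op B) (w x))).
  { intros m n. change (element_type (v x) m n <-> element_type (w x) m n).
    rewrite ht. tauto. }
  induction psi as [s t|s t|phi IH|phi IH psi IH'|phi IH psi IH'|phi IH psi IH'
    |y phi IH|y phi IH]; simpl; intros hq ho; try tauto.
  - rewrite !eval_iter, (ho (term_var s)), (ho (term_var t)) by auto.
    split; intros h.
    + apply aB; apply hle; rewrite h; apply rA.
    + apply aA; apply hle; rewrite h; apply rB.
  - rewrite !eval_iter, (ho (term_var s)), (ho (term_var t)) by auto. apply hle.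
  - rewrite IH, IH' by intuition. tauto.
  - rewrite IH, IH' by intuition. tauto.
  - rewrite IH, IH' by intuition. tauto.
Qed.

(** Each valuation of the matrix involves a single element, so it may be evaluated at an element of
    the same type in a model of [phi]. *)
Lemma one_universal_models A phi :
  one_universal phi -> linearly_ordered A ->
  (forall a : A, exists (B : structure) (b : B), linearly_ordered B /\ models B phi /\
     element_type a = element_type b) ->
  models A phi.
Proof.
  intros (_ & hu & x & hx) hA h.
  destruct (universal_matrix hu) as (psi & hq & ho & hm).
  apply hm. intros v. destruct (h (v x)) as (B & b & hB & hb & ht).
  apply (sat_element_type (x := x) (w := fun _ => b) hA hB ht hq).
  - intros y hy. apply hx. auto.
  - apply hm. auto.
Qed.

Definition reverses (k : op_kind) : bool :=
  match k with op_p | op_sp => false | op_r | op_sr => true end.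

Definition is_strict (k : op_kind) : bool :=
  match k with op_p | op_r => false | op_sp | op_sr => true end.

Lemma op_condition_monotone k A :
  linearly_ordered A ->
  (op_condition k A <->
   monotone_preorder (reverses k) (is_strict k) (le A) (op A)).
Proof.
  intros [[rA tA aA] hA]. split.
  - intros hk. split; auto.
    + intros x y h. destruct k; simpl in *; auto;
        destruct (classic (x = y)) as [->|hn]; auto; apply hk; split; auto.
    + intros hs x y h. destruct (hA x y) as [?|h']; [auto|].
      destruct (classic (y = x)) as [->|hn]; [auto|]. exfalso.
      destruct k; try discriminate; simpl in *;
        destruct (hk y x (conj h' hn)); auto.
  - intros hm. assert (h1 := mp_mono hm). assert (h2 := mp_strict hm).
    destruct k; simpl in *; auto; intros a b [h hn]; split; auto;
      intros e; apply hn, aA; auto; apply h2; auto; rewrite e; auto.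
Qed.

(** Admissible types are taken semantically, as those occurring in the class, so amalgamation and
    the limit never inspect the sentences behind [H]. *)
Definition realized (k : op_kind) (H : condition -> Prop)
    (r : nat -> nat -> Prop) : Prop :=
  exists (A : structure) (a : A), LO k H A /\ r = element_type a.

(** * The class as good linear orders, and a countable extensible member *)

Section MainProof.

Context (k : op_kind) (H : condition -> Prop).
Context (H_one_universal : forall C : condition, H C -> one_universal_condition C).

Definition good_structure (A : structure) : Prop :=
  good (reverses k) (is_strict k) (realized k H) (le A) (op A).

Lemma LO_good A : LO k H A <-> linearly_ordered A /\ good_structure A.
Proof.
  split.
  - intros hA. destruct (hA) as (h1 & h2 & _). split; [auto|]. split.
    + apply op_condition_monotone; auto.
    + intros a. exists A, a. auto.
  - intros [hA [h1 h2]]. split; [auto|]. split; [apply op_condition_monotone; auto|].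
    intros C hC. destruct (H_one_universal hC) as (phi & hphi & hCphi).
    apply hCphi; [auto|]. apply one_universal_models; auto.
    intros a. destruct (h2 a) as (B & b & (hB1 & _ & hB2) & e). exists B, b.
    split; [auto|]. split; [|exact e]. apply hCphi; [auto|].
    apply (hB2 C hC).
Qed.

Lemma embedding_good (A M : structure) (h : A -> M) :
  embedding A M h -> good_structure M -> good_structure A.
Proof.
  intros (_ & h2 & h3) hM. unfold good_structure.
  replace (le A) with (fun a b => le M (h a) (h b)).
  - apply (good_pullback hM h3).
  - extensionality a. extensionality b. apply propositional_extensionality.
    symmetry. apply h2.
Qed.

Lemma embedding_linear (A M : structure) (h : A -> M) :
  embedding A M h -> linearly_ordered M -> linearly_ordered A.
Proof.
  intros (h1 & h2 & _) [[rM tM aM] hM]. split; [split|].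
  - intros a. apply h2, rM.
  - intros a b c. rewrite !h2. apply tM.
  - intros a b. rewrite !h2. intros. apply h1, aM; auto.
  - intros a b. rewrite !h2. apply hM.
Qed.

Definition extensible (M : structure) : Prop :=
  has_extensions (reverses k) (is_strict k) (realized k H) (le M) (op M).

(** The quotient of the limit preorder inherits the extension property by lifting matched lists to
    representatives; a member of the class supplies the point that starts the construction. *)
Lemma extensible_structure :
  (exists A, LO k H A) ->
  exists M : structure, linearly_ordered M /\ good_structure M /\
    extensible M /\ exists enum : nat -> M, Surjective enum.
Proof.
  intros [A hA]. destruct (carrier_inhabited A) as [a].
  destruct (limit_exists a (proj2 (proj1 (LO_good A) hA))) as (P & hP & hext).
  destruct (quotient_structure (0, 0) (good_mp hP))
    as (M & pr & hM & hsurj & hle & hop).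
  assert (hit : forall n u, Nat.iter n (op M) (pr u) = pr (Nat.iter n shift u)).
  { intros n u. symmetry. apply iter_morphism. auto. }
  destruct (choice (fun y u => pr u = y) hsurj) as [rep hrep].
  exists M. split; [auto|]. split; [|split].
  - split; [split|].
    + apply hM.
    + apply hM.
    + intros x y. rewrite <- (hrep x), <- (hrep y), hle.
      intros h. apply (mp_mono (good_mp hP)) in h. rewrite <- !hop.
      destruct (reverses k); apply hle; auto.
    + intros hs x y h. rewrite <- (hrep x), <- (hrep y) in *. apply hle.
      apply (mp_strict (good_mp hP) hs). rewrite <- !hop in h.
      destruct (reverses k); apply hle; auto.
    + intros y. assert (h := good_type hP (rep y)).
      match goal with |- realized _ _ ?r => replace r with (fun m n =>
        P (Nat.iter m shift (rep y)) (Nat.iter n shift (rep y))) end; auto.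
      extensionality m. extensionality n. apply propositional_extensionality.
      rewrite <- (hrep y) at 3 4. rewrite !hit, hle. tauto.
  - intros X L f l x hX hl.
    destruct (hext X L f (map (fun u => (fst u, rep (snd u))) l) x) as [y hy]; auto.
    { intros u v hu hv m n.
      apply in_map_iff in hu as (u' & <- & hu), hv as (v' & <- & hv). simpl.
      rewrite (hl u' v' hu hv). rewrite <- hle, <- !hit, !hrep. tauto. }
    exists (pr y).
    assert (hin : forall u, In u ((x, pr y) :: l) -> exists w,
      In (fst u, w) ((x, y) :: map (fun u => (fst u, rep (snd u))) l) /\
      snd u = pr w).
    { intros u [<-|hu]; [exists y; simpl; auto|].
      exists (rep (snd u)). split; [|auto]. right.
      apply in_map_iff. exists u. auto. }
    intros u v hu hv m n.
    destruct (hin u hu) as (w & hw & ->), (hin v hv) as (z & hz & ->).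
    rewrite !hit, hle. apply (hy _ _ hw hz).
  - exists (fun n => pr (of_nat n)). intros y. exists (to_nat (rep y)).
    rewrite cancel_of_to. auto.
Qed.

(** By antisymmetry, a relation that preserves and reflects [le] is single-valued and injective, so
    maps can be given by their graphs on iterates of generators. *)
Lemma graph_embedding (A M : structure) (G : A -> M -> Prop) :
  linearly_ordered A -> linearly_ordered M ->
  (forall a, exists y, G a y) ->
  (forall a y, G a y -> G (op A a) (op M y)) ->
  (forall a y a' y', G a y -> G a' y' -> (le A a a' <-> le M y y')) ->
  exists h, embedding A M h /\ forall a y, G a y <-> y = h a.
Proof.
  intros [[rA _ aA] _] [[rM _ aM] _] htot hop hle.
  destruct (choice G htot) as [h hh].
  assert (hG : forall a y, G a y <-> y = h a).
  { intros a y. split; [|intros ->; auto].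
    intros hy. apply aM; eapply hle; eauto. }
  exists h. split; [|auto]. split; [|split].
  - intros a b e. apply aA; eapply hle; eauto; rewrite e; auto.
  - intros a b. apply hle; auto.
  - intros a. symmetry. apply hG. auto.
Qed.

Lemma generated_iter (A : structure) l :
  (forall S : A -> Prop, (forall a, In a l -> S a) ->
     (forall a, S a -> S (op A a)) -> forall a, S a) ->
  forall a, exists m c, In c l /\ a = Nat.iter m (op A) c.
Proof.
  intros h. apply h.
  - intros a ha. exists 0, a. auto.
  - intros a (m & c & hc & ->). exists (S m), c. auto.
Qed.

(** * Age, back-and-forth and ultrahomogeneity *)

Section Limit.

Context (M : structure) (M_linear : linearly_ordered M).
Context (M_good : good_structure M) (M_ext : extensible M).

Lemma match_list (A : structure) (l : list A) :
  good_structure A ->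
  exists l', matched (le A) (op A) (le M) (op M) l' /\ map fst l' = l.
Proof.
  intros hA. induction l as [|a l (l' & h & <-)].
  - exists []. split; [|auto]. intros u v [].
  - destruct (M_ext a hA h) as [y hy]. exists ((a, y) :: l'). auto.
Qed.

(** For the converse, generators are matched one by one from the empty list, and their iterates form
    the graph of an embedding. *)
Lemma age_LO A : age M A <-> fg (LO k H) A.
Proof.
  split.
  - intros [hfg [h hh]]. split; [|auto]. apply LO_good.
    split; [eapply embedding_linear|eapply embedding_good]; eauto.
  - intros [hA [l hl]]. split; [exists l; auto|].
    apply LO_good in hA as [hA hA'].
    destruct (match_list l hA') as (l' & hm & hl').
    destruct (@graph_embedding A M (fun a y => exists m u, In u l' /\
      a = Nat.iter m (op A) (fst u) /\ y = Nat.iter m (op M) (snd u)))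
      as (h & hh & _); auto.
    + intros a. destruct (generated_iter hl a) as (m & c & hc & ->).
      rewrite <- hl' in hc. apply in_map_iff in hc as (u & <- & hu).
      exists (Nat.iter m (op M) (snd u)), m, u. auto.
    + intros a y (m & u & hu & -> & ->). exists (S m), u. auto.
    + intros a y a' y' (m & u & hu & -> & ->) (m' & u' & hu' & -> & ->).
      apply hm; auto.
    + exists h. auto.
Qed.

Context (enum : nat -> M) (enum_surj : Surjective enum).

(** The second half is the same extension property applied to the swapped list. *)
Lemma back_and_forth_step (l : list (M * M)) z :
  matched (le M) (op M) (le M) (op M) l ->
  exists l', matched (le M) (op M) (le M) (op M) l' /\ incl l l' /\
    (exists y, In (z, y) l') /\ exists x, In (x, z) l'.
Proof.
  intros h. destruct (M_ext z M_good h) as [y hy].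
  destruct (M_ext z M_good (matched_swap hy)) as [x hx].
  exists ((x, z) :: (z, y) :: l). split; [|split; [|split]].
  - apply matched_swap in hx. simpl in hx. rewrite map_map in hx.
    replace (map (fun u => (snd (snd u, fst u), fst (snd u, fst u))) l)
      with l in hx; [auto|].
    rewrite <- (map_id l) at 1. apply map_ext. intros []; auto.
  - intros u hu. simpl. auto.
  - exists y. simpl. auto.
  - exists x. simpl. auto.
Qed.

(** Stage [n + 1] contains [enum n] both as a first and as a second entry, so the stages together
    generate the graph of a surjective embedding. *)
Lemma matched_automorphism (l : list (M * M)) :
  matched (le M) (op M) (le M) (op M) l ->
  exists g, isomorphism M M g /\ forall u, In u l -> snd u = g (fst u).
Proof.
  intros hl.
  set (G := {l | matched (le M) (op M) (le M) (op M) l}).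
  destruct (choice (fun (a : nat * G) (l' : G) =>
    incl (proj1_sig (snd a)) (proj1_sig l') /\
    (exists y, In (enum (fst a), y) (proj1_sig l')) /\
    exists x, In (x, enum (fst a)) (proj1_sig l'))) as [next hnext].
  { intros [n [l1 h1]]. destruct (back_and_forth_step (enum n) h1) as (l' & h2 & h3).
    exists (exist _ l' h2). exact h3. }
  set (stage := fix stage n : G :=
    match n with 0 => exist _ l hl | S n => next (n, stage n) end).
  set (ls := fun n => proj1_sig (stage n)).
  assert (hmono : forall n n', n <= n' -> incl (ls n) (ls n')).
  { intros n n' h. induction h as [|n' h IH]; [apply incl_refl|].
    apply incl_tran with (ls n'); [auto|]. apply (hnext (n', stage n')). }
  destruct (@graph_embedding M M (fun a y => exists n m u, In u (ls n) /\
      a = Nat.iter m (op M) (fst u) /\ y = Nat.iter m (op M) (snd u)))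
      as (g & hg & hG); auto.
  - intros a. destruct (enum_surj a) as [n <-].
    destruct (hnext (n, stage n)) as (_ & [y hy] & _).
    exists y, (S n), 0, (enum n, y). auto.
  - intros a y (n & m & u & hu & -> & ->). exists n, (S m), u. auto.
  - intros a y a' y' (n & m & u & hu & -> & ->) (n' & m' & u' & hu' & -> & ->).
    apply (proj2_sig (stage (max n n'))).
    + apply (hmono n); [lia|auto].
    + apply (hmono n'); [lia|auto].
  - exists g. split; [split; [auto|]|].
    + intros y. destruct (enum_surj y) as [n <-].
      destruct (hnext (n, stage n)) as (_ & _ & [x hx]).
      exists x. symmetry. apply hG. exists (S n), 0, (x, enum n). auto.
    + intros u hu. apply hG. exists 0, 0, u. auto.
Qed.

(** The isomorphism is matched on a list of generators; an automorphism extending that list agrees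
    with it on all their iterates. *)
Lemma extensible_ultrahomogeneous : ultrahomogeneous M.
Proof.
  intros U V h [gl hgl] _ [(h1 & h2 & h3) _].
  assert (hU : forall m s, Nat.iter m (op M) (proj1_sig s) =
    proj1_sig (Nat.iter m (op (induced U)) s)).
  { intros m s. symmetry. apply (iter_morphism (h := @proj1_sig _ _)). auto. }
  assert (hV : forall m s, Nat.iter m (op M) (proj1_sig (h s)) =
    proj1_sig (h (Nat.iter m (op (induced U)) s))).
  { intros m s. symmetry.
    apply (iter_morphism (h := fun s => proj1_sig (h s))).
    intros y. rewrite h3. auto. }
  destruct (@matched_automorphism
    (map (fun s => (proj1_sig s, proj1_sig (h s))) gl)) as (g & hg & hgh).
  { intros u v hu hv m n.
    apply in_map_iff in hu as (s & <- & hs), hv as (t & <- & ht).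
    cbn [fst snd]. rewrite !hU, !hV. apply h2. }
  exists g. split; [auto|].
  intros a. destruct (generated_iter hgl a) as (m & c & hc & ->).
  rewrite <- hU, <- hV.
  rewrite (iter_morphism (f := op M) (h := g)) by apply hg. f_equal.
  symmetry. apply (hgh (proj1_sig c, proj1_sig (h c))).
  apply in_map_iff. exists c. auto.
Qed.

Lemma extensible_fraisse : fraisse_limit (fg (LO k H)) M.
Proof.
  split; [|split].
  - destruct (choice (fun y n => enum n = y) enum_surj) as [c hc].
    exists c. intros x y e. rewrite <- (hc x), <- (hc y), e. auto.
  - apply extensible_ultrahomogeneous.
  - apply age_LO.
Qed.

End Limit.

End MainProof.

Theorem theorem5p2 (k : op_kind) (H : condition -> Prop)
    (H_one_universal : forall C : condition, H C -> one_universal_condition C)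
    (K_nonempty : exists A : structure, LO k H A) :
  exists M : structure, fraisse_limit (fg (LO k H)) M /\ LO k H M.
Proof.
  destruct (extensible_structure H_one_universal K_nonempty)
    as (M & hM & hgood & hext & enum & hsurj).
  exists M. split.
  - apply (extensible_fraisse H_one_universal hM hgood hext hsurj).
  - apply LO_good; auto.
Qed.
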